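(* Let $m\geq n\geq 1$ be integers with $m+n$ even, and let $\varepsilon\in\{0,1\}$. Then \[ \int_0^\infty \frac{\tanh^{m+\varepsilon}x}{x^{n+\varepsilon}\cosh^{1-\varepsilon}x}\,dx = (-1)^{\frac{m-n}{2}} \sum_{p=\lceil n/2\rceil}^{(m+n)/2} \binom{2p-1+\varepsilon}{n-1+\varepsilon} \frac{\Phi\!\left(2\varepsilon-1,\,2p+\varepsilon,\,\frac12\right)}{\pi^{2p-1+\varepsilon}}\, [u^{m+n-2p}]\left(\frac{u}{\sin u}\right)^{1-\varepsilon}(u\cot u)^{m+\varepsilon}. \]
   Context: $\Phi(q,s,a)=\sum_{j=0}^{\infty}\frac{q^j}{(j+a)^s}$ is the Lerch transcendent (in its domain of convergence). With $\beta(s)=\sum_{j\ge0}(-1)^j(2j+1)^{-s}$ the Dirichlet beta function and $\zeta$ the Riemann zeta function, $\Phi(2\varepsilon-1,2p+\varepsilon,\frac12)$ equals $2^{2p}\beta(2p)$ for $\varepsilon=0$ and $(2^{2p+1}-1)\zeta(2p+1)$ for $\varepsilon=1$. $[u^r]F(u)$ denotes the coefficient of $u^r$ in the expansion of $F$ at the origin; $u/\sin u$ and $u\cot u$ are extended analytically to $u=0$ with value $1$. *)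

(* Defs.v *)
From Stdlib Require Import Reals.
From Coquelicot Require Import Coquelicot.
Open Scope R_scope.

(* Real parameters; [Rpower] is the intended power only where j + a > 0,
   i.e. for a > 0. [Series] is the limit of the partial sums, so conditionally
   convergent cases are included. *)
Definition Lerch (q s a : R) : R :=
  Series (fun j : nat => q ^ j / Rpower (INR j + a) s).

Definition is_expansion (F : R -> R) (a : nat -> R) : Prop :=
  locally 0 (fun u : R => is_pseries a u (F u)).

(* [u^r] F(u). [iota] is definite description: the value is meaningful when F
   has an expansion at 0, which is then unique. *)
Definition coef (r : nat) (F : R -> R) : R :=
  iota (fun c : R => exists a : nat -> R, is_expansion F a /\ a r = c).

Definition u_over_sin (u : R) : R :=
  if Req_EM_T u 0 then 1 else u / sin u.

Definition u_cot (u : R) : R :=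
  if Req_EM_T u 0 then 1 else u * (cos u / sin u).

(* Main.v *)
Require Import Defs.
From Stdlib Require Import Reals Lra Lia Psatz.
From Coquelicot Require Import Coquelicot.
Open Scope R_scope.

(** Write [d = 1 - eps], [M = m + eps], [N = n + eps], [f_M = tanh^M / cosh^d] and
    regularise [x^-N] as [Re (x + i y)^-N] with [y > 0]. Since
    [f_M' = M f_(M-1) - (M + d) f_(M+1)], integration by parts reduces the regularised
    moments to those of [tanh] (for [d = 0]) and of [1 / cosh] (for [d = 1]), which come
    term by term from the partial fraction expansions over the poles [i pi (j + 1/2)],
    each term giving [+- pi / (pole + y)^N]. The expansions themselves are the convergence
    at [0] of the Fourier series of [sinh (x (1 - t))] and [cosh (x t)] in the functions
    [cos (pi (j + 1/2) t)]. The coefficients produced by the recursion are those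
    of [(u / sin u)^d (u cot u)^M], because [W_M = (u / sin u)^d (u cot u)^M] satisfies
    [u W_M' = (M + d) W_M - (M + d) W_(M+1) - M u^2 W_(M-1)]. Finally [y] tends to [0]. *)

(** Integration by parts trades [tanh^(M+1) / x^N] for terms with a smaller power of [tanh] or a
    larger power of [x] below, and these diverge at 0 when taken separately. With [y > 0] no term is
    singular, so the whole recursion runs at fixed [y], and the condition [N <= M] enters with the
    domination as [y] tends to 0. The recursion preserves the parity of [M + N]. For [M + N] even,
    the boundary terms at 0 vanish and the real part is the component whose integral has a closed
    form. The sign of [y] matters as well: the singularity [- i y] lies in the lower half plane, so
    only the poles [i pi (j + 1/2)] above the axis leave a trace, at distance [pole + y]. No contour
    is drawn. A single pole is reduced by partial fractions to two arctangents, and the sign of the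
    pole decides whether these add to [pi] or cancel. Each limit (partial sums of the expansions,
    then [y] to 0) is taken under the integral by bounding the error by a small multiple of a fixed
    weight with bounded primitive. *)

(** * Improper integrals over the positive half line *)

Definition is_RInt_pos (f : R -> R) (l : R) : Prop :=
  is_RInt_gen f (at_right 0) (Rbar_locally p_infty) l.

Lemma pos_interval_eventually :
  filter_prod (at_right 0) (Rbar_locally p_infty)
    (fun ab : R * R => 0 < fst ab < snd ab).
Proof.
  exists (fun a => 0 < a < 1) (fun b => 1 < b).
  - exists (mkposreal 1 Rlt_0_1). intros y Hy Hy0.
    apply AbsRing_norm_compat2 in Hy. revert Hy.
    unfold abs, minus, plus, opp; simpl. intros Hy.
    apply Rabs_def2 in Hy. lra.
  - exists 1. auto.
  - simpl; intros a b Ha Hb; lra.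
Qed.

Lemma is_RInt_pos_ext (f g : R -> R) (l : R) :
  (forall x, 0 < x -> f x = g x) -> is_RInt_pos f l -> is_RInt_pos g l.
Proof.
  intros H Hf. apply (is_RInt_gen_ext f); trivial.
  generalize pos_interval_eventually. apply filter_imp.
  intros [a b]; simpl; intros Hab x Hx.
  rewrite Rmin_left, Rmax_right in Hx by lra. apply H; lra.
Qed.

Lemma is_RInt_pos_plus (f g : R -> R) (lf lg : R) :
  is_RInt_pos f lf -> is_RInt_pos g lg ->
  is_RInt_pos (fun x => f x + g x) (lf + lg).
Proof. exact (is_RInt_gen_plus f g lf lg). Qed.

Lemma is_RInt_pos_minus (f g : R -> R) (lf lg : R) :
  is_RInt_pos f lf -> is_RInt_pos g lg ->
  is_RInt_pos (fun x => f x - g x) (lf - lg).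
Proof. exact (is_RInt_gen_minus f g lf lg). Qed.

Lemma is_RInt_pos_scal (f : R -> R) (k l : R) :
  is_RInt_pos f l -> is_RInt_pos (fun x => k * f x) (k * l).
Proof. exact (is_RInt_gen_scal f k l). Qed.

Lemma is_RInt_pos_derive (F f : R -> R) (A B : R) :
  (forall x, 0 < x -> is_derive F x (f x)) ->
  (forall x, 0 < x -> continuous f x) ->
  filterlim F (at_right 0) (locally A) ->
  filterlim F (Rbar_locally p_infty) (locally B) ->
  is_RInt_pos f (B - A).
Proof.
  intros HF Hf HA HB.
  apply (filterlimi_locally (F := filter_prod (at_right 0) (Rbar_locally p_infty))).
  intros eps.
  assert (He : 0 < eps / 2) by (generalize (cond_pos eps); lra).
  specialize (HA _ (locally_ball A (mkposreal _ He))).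
  specialize (HB _ (locally_ball B (mkposreal _ He))).
  unfold filtermap in HA, HB.
  assert (HAB : filter_prod (at_right 0) (Rbar_locally p_infty)
            (fun ab : R * R => ball A (mkposreal _ He) (F (fst ab))
                        /\ ball B (mkposreal _ He) (F (snd ab)))).
  { exists (fun a => ball A (mkposreal _ He) (F a)) (fun b => ball B (mkposreal _ He) (F b)); auto. }
  generalize (filter_and _ _ pos_interval_eventually HAB).
  apply filter_imp. intros [a b]; simpl. intros [Hab [Ha Hb]].
  exists (F b - F a). split.
  - apply (is_RInt_derive F f); intros x Hx;
      rewrite Rmin_left, Rmax_right in Hx by lra; [apply HF | apply Hf]; lra.
  - unfold ball in *; simpl in *; unfold AbsRing_ball, abs, minus, plus, opp in *; simpl in *.
    apply Rabs_def2 in Ha. apply Rabs_def2 in Hb. apply Rabs_def1; lra.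
Qed.

(* Bounding the error by [eps * w] with [w] having a bounded primitive gives the
   dominated passage to the limit without any integral of [w]. *)
Lemma is_RInt_pos_approx (f w W : R -> R) (B L : R) :
  (forall x, 0 < x -> continuous f x) ->
  (forall x, 0 < x -> is_derive W x (w x)) ->
  (forall x, 0 < x -> continuous w x) ->
  (forall x, 0 < x -> Rabs (W x) <= B) ->
  (forall eps : R, 0 < eps -> exists (g : R -> R) (l : R),
      is_RInt_pos g l /\ Rabs (l - L) <= eps /\
      forall x, 0 < x -> Rabs (f x - g x) <= eps * w x) ->
  is_RInt_pos f L.
Proof.
  intros Hf HW Hw HB H.
  apply (filterlimi_locally (F := filter_prod (at_right 0) (Rbar_locally p_infty))).
  intros eps. generalize (cond_pos eps); intros Heps.
  assert (HB0 : 0 <= B) by (generalize (HB 1 Rlt_0_1) (Rabs_pos (W 1)); lra).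
  (* Three errors add up: [e] for [g] on [[a, b]] against [l], [e] for [l] against [L], and
     [e * (W b - W a) <= 2 * B * e] for [f] against [g]. The total [e * (2 * B + 2)] is strictly
     below [eps]. *)
  set (e := eps / (2 * B + 3)).
  assert (He : 0 < e) by (apply Rdiv_lt_0_compat; lra).
  assert (Hee : e * (2 * B + 3) = eps) by (unfold e; field; lra).
  destruct (H e He) as [g [l [Hg [Hl Hfg]]]].
  apply (filterlimi_locally (F := filter_prod (at_right 0) (Rbar_locally p_infty))) with (eps := mkposreal e He) in Hg.
  generalize (filter_and _ _ pos_interval_eventually Hg).
  apply filter_imp. intros [a b]; simpl. intros [Hab [I [HI HIl]]].
  assert (Hex : ex_RInt f a b).
  { apply (ex_RInt_continuous f). intros x Hx.
    rewrite Rmin_left, Rmax_right in Hx by lra. apply Hf; lra. }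
  exists (RInt f a b). split. { apply (RInt_correct f); trivial. }
  assert (HRW : is_RInt (fun x => e * w x) a b (e * (W b - W a))).
  { apply (is_RInt_scal w a b e (W b - W a)). apply (is_RInt_derive W w);
      intros x Hx; rewrite Rmin_left, Rmax_right in Hx by lra; [apply HW | apply Hw]; lra. }
  assert (HD : Rabs (RInt f a b - I) <= e * (W b - W a)).
  { apply (norm_RInt_le (V := R_NormedModule) (fun x => f x - g x) (fun x => e * w x) a b); try lra.
    - intros x Hx. apply Hfg; lra.
    - apply (is_RInt_minus f g a b (RInt f a b) I); trivial. apply (RInt_correct f); trivial.
    - trivial. }
  assert (HWab : W b - W a <= 2 * B).
  { generalize (HB a ltac:(lra)) (HB b ltac:(lra)). intros h1 h2.
    apply Rabs_le_between in h1. apply Rabs_le_between in h2. lra. }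
  unfold ball in *; simpl in *; unfold AbsRing_ball, abs, minus, plus, opp in *; simpl in *.
  apply Rabs_def2 in HIl. apply Rabs_le_between in HD. apply Rabs_le_between in Hl.
  assert (e * (W b - W a) <= e * (2 * B)) by (apply Rmult_le_compat_l; lra).
  apply Rabs_def1; nra.
Qed.

(** * Half-integer Fourier series: the Dirichlet kernel and convergence at 0 *)

Definition pole (j : nat) : R := PI * (INR j + 1 / 2).

Lemma pole_gt_1 (j : nat) : 1 < pole j.
Proof.
  unfold pole. generalize PI2_1 (pos_INR j). intros H1 H2.
  assert (0 <= PI * INR j) by (apply Rmult_le_pos; lra). lra.
Qed.

Lemma pole_pos (j : nat) : 0 < pole j.
Proof. generalize (pole_gt_1 j); lra. Qed.

Lemma pole_S (j : nat) : pole (S j) = pole j + PI.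
Proof. unfold pole. rewrite S_INR. ring. Qed.

Lemma cos_sin_pole (j : nat) : cos (pole j) = 0 /\ sin (pole j) = (-1) ^ j.
Proof.
  induction j as [|j [IHc IHs]].
  - unfold pole. simpl INR. replace (PI * (0 + 1 / 2)) with (PI / 2) by field.
    rewrite cos_PI2, sin_PI2. split; simpl; ring.
  - rewrite pole_S, neg_cos, neg_sin, IHc, IHs. split; simpl; ring.
Qed.

Definition dirichlet (K : nat) (t : R) : R :=
  sum_n (fun j => 2 * cos (pole j * t)) K.

(** The sum telescopes under [2 cos A sin B = sin (A + B) - sin (A - B)], because consecutive poles
    differ by [PI], which is twice the frequency [PI / 2]. *)
Lemma dirichlet_sin (K : nat) (t : R) :
  dirichlet K t * sin (PI / 2 * t) = sin (INR (S K) * PI * t).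
Proof.
  assert (HP : forall A B, 2 * cos A * sin B = sin (A + B) - sin (A - B))
    by (intros A B; rewrite sin_plus, sin_minus; ring).
  unfold dirichlet. induction K as [|K IH].
  - rewrite sum_O, HP. unfold pole. simpl INR.
    replace (PI * (0 + 1 / 2) * t - PI / 2 * t) with 0 by field.
    replace (PI * (0 + 1 / 2) * t + PI / 2 * t) with (1 * PI * t) by field.
    rewrite sin_0. ring.
  - rewrite sum_Sn. unfold plus; simpl plus. rewrite Rmult_plus_distr_r, IH, HP.
    unfold pole. rewrite !S_INR.
    replace (PI * (INR K + 1 + 1 / 2) * t - PI / 2 * t) with ((INR K + 1) * PI * t) by field.
    replace (PI * (INR K + 1 + 1 / 2) * t + PI / 2 * t) with ((INR K + 1 + 1) * PI * t) by field.
    ring.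
Qed.

Lemma dirichlet_continuous (K : nat) (t : R) : continuous (dirichlet K) t.
Proof.
  unfold dirichlet. induction K as [|K IH].
  - apply continuous_ext with (fun t => 2 * cos (pole 0 * t)).
    { intros x. now rewrite sum_O. }
    apply (ex_derive_continuous (fun t => 2 * cos (pole 0 * t))). auto_derive. trivial.
  - apply continuous_ext with
      (fun t => plus (sum_n (fun j => 2 * cos (pole j * t)) K) (2 * cos (pole (S K) * t))).
    { intros x. now rewrite sum_Sn. }
    apply (continuous_plus (V := R_NormedModule)); trivial.
    apply (ex_derive_continuous (fun t => 2 * cos (pole (S K) * t))). auto_derive. trivial.
Qed.

(** Here [u <= 2], hence [u * u <= 4], and on that range the Taylor lower bound divided by [u] stays
    above 1/4. The constant is not sharp; only a linear lower bound matters. *)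
Lemma sin_ge_quarter (u : R) : 0 <= u <= PI / 2 -> u / 4 <= sin u.
Proof.
  intros Hu. generalize PI_4; intros HP.
  destruct (SIN u) as [H _]; try lra.
  apply Rle_trans with (2 := H).
  replace (sin_lb u) with (u * (1 - u * u / 6 + (u * u) * (u * u) / 120 - (u * u) * (u * u) * (u * u) / 5040)).
  2:{ unfold sin_lb, sin_approx, sin_term. simpl sum_f_R0. simpl. field. }
  assert (0 <= u * u <= 4) by nra.
  set (s := u * u) in *.
  replace (u * / 4) with (u * (1 / 4)) by field.
  apply Rmult_le_compat_l; nra.
Qed.

(** The bound does not depend on [K]. It controls the kernel near 0, where oscillation cannot be
    exploited uniformly. *)
Lemma dirichlet_bound (K : nat) (t : R) : 0 <= t <= 1 -> Rabs (dirichlet K t) * t <= 4.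
Proof.
  intros Ht. generalize (dirichlet_sin K t) PI2_1 ; intros H HP.
  assert (H1 : t / 4 <= sin (PI / 2 * t)).
  { apply Rle_trans with (PI / 2 * t / 4). nra. apply sin_ge_quarter. nra. }
  assert (H2 : Rabs (dirichlet K t * sin (PI / 2 * t)) <= 1).
  { rewrite H. apply Rabs_le. apply SIN_bound. }
  rewrite Rabs_mult, (Rabs_right (sin _)) in H2 by lra.
  generalize (Rabs_pos (dirichlet K t)). nra.
Qed.

(** One integration by parts moves the derivative onto [chi] and gains [/ om]; [C] collects the two
    boundary values and the integral of [Rabs (dchi t)]. *)
Lemma riemann_lebesgue_C1 (chi dchi : R -> R) (a b : R) :
  a <= b ->
  (forall t, a <= t <= b -> is_derive chi t (dchi t)) ->
  (forall t, a <= t <= b -> continuous dchi t) ->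
  exists C, forall om, 0 < om ->
    Rabs (RInt (fun t => chi t * sin (om * t)) a b) <= C / om.
Proof.
  intros Hab Hd Hc.
  assert (Hex : ex_RInt (fun t => Rabs (dchi t)) a b).
  { apply (ex_RInt_continuous (fun t => Rabs (dchi t))). intros t Ht.
    rewrite Rmin_left, Rmax_right in Ht by lra.
    apply (continuous_comp dchi Rabs); [now apply Hc | apply (continuous_Rabs)]. }
  exists (Rabs (chi a) + Rabs (chi b) + RInt (fun t => Rabs (dchi t)) a b).
  intros om Hom.
  assert (Hcc : forall t, a <= t <= b -> continuous (fun t => dchi t * cos (om * t)) t).
  { intros t Ht. apply (continuous_mult dchi (fun t => cos (om * t))); [now apply Hc|].
    apply (ex_derive_continuous (fun t => cos (om * t))). auto_derive; trivial. }
  assert (Hcs : forall t, a <= t <= b -> continuous (fun t => chi t * sin (om * t)) t).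
  { intros t Ht. apply (continuous_mult chi (fun t => sin (om * t))).
    apply (ex_derive_continuous chi). eexists. now apply Hd.
    apply (ex_derive_continuous (fun t => sin (om * t))). auto_derive; trivial. }
  assert (H : is_RInt (fun t => chi t * sin (om * t) - / om * (dchi t * cos (om * t))) a b
     (- / om * (chi b * cos (om * b)) - (- / om * (chi a * cos (om * a))))).
  { apply (is_RInt_derive (fun t => - / om * (chi t * cos (om * t)))); intros t Ht;
      rewrite Rmin_left, Rmax_right in Ht by lra.
    - auto_derive. { exists (dchi t). now apply Hd. }
      replace (Derive (fun x => chi x) t) with (dchi t)
        by (symmetry; apply is_derive_unique; now apply Hd). field. lra.
    - apply (continuous_minus (fun t => chi t * sin (om * t)) (fun t => / om * (dchi t * cos (om * t)))); auto.
      apply (continuous_scal_r (/ om) (fun t => dchi t * cos (om * t))); auto. }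
  assert (E1 : ex_RInt (fun t => chi t * sin (om * t)) a b).
  { apply (ex_RInt_continuous (fun t => chi t * sin (om * t))). intros t Ht.
    rewrite Rmin_left, Rmax_right in Ht by lra. auto. }
  assert (E2 : ex_RInt (fun t => dchi t * cos (om * t)) a b).
  { apply (ex_RInt_continuous (fun t => dchi t * cos (om * t))). intros t Ht.
    rewrite Rmin_left, Rmax_right in Ht by lra. auto. }
  assert (H' : RInt (fun t => chi t * sin (om * t)) a b - / om * RInt (fun t => dchi t * cos (om * t)) a b
    = (- / om * (chi b * cos (om * b)) - (- / om * (chi a * cos (om * a))))).
  { rewrite <- (is_RInt_unique _ _ _ _ H). symmetry. apply is_RInt_unique.
    apply (is_RInt_minus (fun t => chi t * sin (om * t)) (fun t => / om * (dchi t * cos (om * t)))).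
    - now apply (RInt_correct (fun t => chi t * sin (om * t))).
    - apply (is_RInt_scal (fun t => dchi t * cos (om * t)) a b (/ om) (RInt (fun t => dchi t * cos (om * t)) a b)).
      now apply (RInt_correct (fun t => dchi t * cos (om * t))). }
  assert (H2 : Rabs (RInt (fun t => dchi t * cos (om * t)) a b) <= RInt (fun t => Rabs (dchi t)) a b).
  { apply (norm_RInt_le (V := R_NormedModule) (fun t => dchi t * cos (om * t)) (fun t => Rabs (dchi t)) a b); trivial.
    - intros t Ht. change (norm (dchi t * cos (om * t))) with (Rabs (dchi t * cos (om * t))).
      rewrite Rabs_mult. rewrite <- (Rmult_1_r (Rabs (dchi t))) at 2.
      apply Rmult_le_compat_l. apply Rabs_pos. apply Rabs_le, COS_bound.
    - now apply (RInt_correct (fun t => dchi t * cos (om * t))).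
    - now apply (RInt_correct (fun t => Rabs (dchi t))). }
  assert (HC : forall u v, Rabs (u * cos v) <= Rabs u).
  { intros u v. rewrite Rabs_mult. rewrite <- (Rmult_1_r (Rabs u)) at 2.
    apply Rmult_le_compat_l. apply Rabs_pos. apply Rabs_le, COS_bound. }
  replace (RInt (fun t => chi t * sin (om * t)) a b) with
   ((chi a * cos (om * a) - chi b * cos (om * b) + RInt (fun t => dchi t * cos (om * t)) a b) / om).
  2:{ apply Rminus_diag_uniq. 
      replace (RInt (fun t => chi t * sin (om * t)) a b) with
       (/ om * RInt (fun t => dchi t * cos (om * t)) a b + (- / om * (chi b * cos (om * b)) - (- / om * (chi a * cos (om * a))))) by lra.
      field. lra. }
  unfold Rdiv. rewrite Rabs_mult, (Rabs_right (/ om)) by (generalize (Rinv_0_lt_compat _ Hom); lra).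
  apply Rmult_le_compat_r. { generalize (Rinv_0_lt_compat _ Hom); lra. }
  eapply Rle_trans; [apply Rabs_triang|]. apply Rplus_le_compat; trivial.
  eapply Rle_trans; [apply Rabs_triang|]. rewrite Rabs_Ropp.
  apply Rplus_le_compat; apply HC.
Qed.

(** This is the Leibniz series for [PI / 4] multiplied by [4 / PI]. It gives the limiting mass of
    the kernel on [[0, 1]]. *)
Lemma leibniz_pole : is_lim_seq (sum_n (fun j => 2 * ((-1) ^ j / pole j))) 1.
Proof.
  generalize Alt_PI_eq. unfold Alt_PI. destruct exist_PI as [l Hl]. intros E.
  apply is_lim_seq_Reals in Hl.
  assert (Hl1 : 4 / PI * l = 1) by (rewrite <- E; field; generalize PI_RGT_0; lra).
  apply (is_lim_seq_scal_l _ (4 / PI)) in Hl. simpl in Hl. rewrite Hl1 in Hl.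
  revert Hl. apply is_lim_seq_ext. intros n. rewrite <- sum_n_Reals.
  rewrite <- (sum_n_mult_l (K := R_Ring)). apply sum_n_ext. intros j.
  change (4 / PI * tg_alt PI_tg j = 2 * ((-1) ^ j / pole j)).
  unfold tg_alt, PI_tg, pole. rewrite plus_INR, mult_INR. simpl INR.
  field. split; generalize (pos_INR j) PI_RGT_0; lra.
Qed.

Lemma is_RInt_sum_n (f : nat -> R -> R) (l : nat -> R) (a b : R) (K : nat) :
  (forall j, is_RInt (f j) a b (l j)) ->
  is_RInt (fun t => sum_n (fun j => f j t) K) a b (sum_n l K).
Proof.
  intros H. induction K as [|K IH].
  - rewrite sum_O. apply (is_RInt_ext (f 0%nat)); trivial. intros t _. now rewrite sum_O.
  - rewrite sum_Sn. apply (is_RInt_ext (fun t => plus (sum_n (fun j => f j t) K) (f (S K) t))).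
    { intros t _. now rewrite sum_Sn. }
    now apply (is_RInt_plus (V := R_NormedModule)).
Qed.

Lemma RInt_dirichlet (K : nat) :
  RInt (dirichlet K) 0 1 = sum_n (fun j => 2 * ((-1) ^ j / pole j)) K.
Proof.
  apply is_RInt_unique. apply (is_RInt_sum_n (fun j t => 2 * cos (pole j * t))). intros j.
  generalize (pole_pos j); intros Hp. destruct (cos_sin_pole j) as [_ Hs].
  replace (2 * ((-1) ^ j / pole j)) with
    (2 / pole j * sin (pole j * 1) - 2 / pole j * sin (pole j * 0)).
  - apply (is_RInt_derive (fun t => 2 / pole j * sin (pole j * t)) (fun t => 2 * cos (pole j * t))).
    + intros t _. auto_derive; trivial. field. lra.
    + intros t _. apply (ex_derive_continuous (fun t => 2 * cos (pole j * t))). auto_derive; trivial.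
  - rewrite Rmult_1_r, Rmult_0_r, sin_0, Hs. field. lra.
Qed.

(** The constant part [psi 0] is handled by [leibniz_pole]. The remainder [psi t - psi 0] is at most
    [L * t], so near 0 it absorbs the [1 / t] growth of the kernel; away from 0 the quotient by
    [sin (PI / 2 * t)] is C1 and the Riemann-Lebesgue estimate applies at frequency
    [(K + 1) * PI]. *)
Lemma RInt_dirichlet_lim (psi dpsi : R -> R) :
  (forall t, is_derive psi t (dpsi t)) -> (forall t, continuous dpsi t) ->
  is_lim_seq (fun K => RInt (fun t => psi t * dirichlet K t) 0 1) (psi 0).
Proof.
  intros Hd Hc.
  assert (Hcp : forall t, continuous psi t).
  { intros t. apply (ex_derive_continuous psi). now exists (dpsi t). }
  assert (HL : exists L, 0 < L /\ forall t, 0 <= t <= 1 -> Rabs (psi t - psi 0) <= L * t).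
  { destruct (continuity_ab_maj (fun t => Rabs (dpsi t)) 0 1) as [m [Hm _]]; try lra.
    { intros t _. apply continuity_pt_filterlim.
      apply (continuous_comp dpsi Rabs); [apply Hc | apply continuous_Rabs]. }
    exists (Rabs (dpsi m) + 1). split. { generalize (Rabs_pos (dpsi m)); lra. }
    intros t Ht. destruct (MVT_gen psi 0 t dpsi) as [c [Hc1 Hc2]].
    - intros; apply Hd.
    - intros x _. apply continuity_pt_filterlim, Hcp.
    - rewrite Rmin_left, Rmax_right in Hc1 by lra. rewrite Hc2, Rabs_mult, Rminus_0_r.
      rewrite (Rabs_right t) by lra. apply Rmult_le_compat_r; try lra.
      generalize (Hm c ltac:(lra)); lra. }
  destruct HL as [L [HL0 HL]].
  set (g := fun K t => (psi t - psi 0) * dirichlet K t).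
  assert (Hgc : forall K t, continuous (g K) t).
  { intros K t. apply (continuous_mult (fun t => psi t - psi 0) (dirichlet K)).
    - apply (continuous_minus psi (fun _ => psi 0)). apply Hcp. apply continuous_const.
    - apply dirichlet_continuous. }
  assert (Hgex : forall K a b, ex_RInt (g K) a b).
  { intros K a b. apply (ex_RInt_continuous (g K)). intros; apply Hgc. }
  assert (Hg : is_lim_seq (fun K => RInt (g K) 0 1) 0).
  { apply is_lim_seq_spec. intros eps. generalize (cond_pos eps); intros Heps.
    (* The second entry makes the contribution [4 * L * e] of [[0, e]] at most [eps / 2]; the first
       keeps [e] inside [[0, 1]]. *)
    set (e := Rmin (1 / 2) (eps / (8 * L))).
    assert (He : 0 < e <= 1 / 2).
    { split. apply Rmin_pos. lra. apply Rdiv_lt_0_compat; lra. apply Rmin_l. }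
    assert (HeL : 4 * L * e <= eps / 2).
    { apply Rle_trans with (4 * L * (eps / (8 * L))).
      apply Rmult_le_compat_l. lra. apply Rmin_r. right. field. lra. }
    set (s := fun t => sin (PI / 2 * t)). set (ds := fun t => PI / 2 * cos (PI / 2 * t)).
    assert (Hs : forall t, e <= t <= 1 -> 0 < s t).
    { intros t Ht. unfold s. generalize PI2_1; intros HP.
      generalize (sin_ge_quarter (PI / 2 * t)). intros Hq.
      assert (0 < PI / 2 * t) by nra. assert (PI / 2 * t <= PI / 2) by nra. lra. }
    destruct (riemann_lebesgue_C1 (fun t => (psi t - psi 0) / s t)
       (fun t => (dpsi t * s t - (psi t - psi 0) * ds t) / (s t * s t)) e 1) as [C HC]; try lra.
    { intros t Ht. generalize (Hs t Ht); intros Hst. unfold s in Hst |- *.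
      auto_derive. { repeat split; trivial. now exists (dpsi t). lra. }
      replace (Derive (fun x => psi x) t) with (dpsi t)
        by (symmetry; apply is_derive_unique; apply Hd).
      unfold ds. field. lra. }
    { intros t Ht. generalize (Hs t Ht); intros Hst.
      apply (continuous_mult (fun t => dpsi t * s t - (psi t - psi 0) * ds t) (fun t => / (s t * s t))).
      - apply (continuous_minus (fun t => dpsi t * s t) (fun t => (psi t - psi 0) * ds t)).
        + apply (continuous_mult dpsi s). apply Hc.
          apply (ex_derive_continuous s). unfold s. auto_derive; trivial.
        + apply (continuous_mult (fun t => psi t - psi 0) ds).
          apply (continuous_minus psi (fun _ => psi 0)). apply Hcp. apply continuous_const.
          apply (ex_derive_continuous ds). unfold ds. auto_derive; trivial.
      - apply (ex_derive_continuous (fun t => / (s t * s t))). unfold s in *. auto_derive. nra. }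
    assert (HC0 : 0 <= C).
    { generalize (HC 1 Rlt_0_1). intros H. 
      generalize (Rle_trans _ _ _ (Rabs_pos _) H). lra. }
    (* Beyond this [N] the oscillatory part satisfies [C / ((K + 1) * PI) < eps / 2]. *)
    destruct (nfloor_ex (2 * C / (PI * eps))) as [N [_ HN]].
    { generalize PI_RGT_0. intros. apply Rdiv_le_0_compat. lra. nra. }
    exists N. intros K HK. rewrite Rminus_0_r.
    rewrite <- (RInt_Chasles (g K) 0 e 1) by apply Hgex.
    assert (H1 : Rabs (RInt (g K) 0 e) <= 4 * L * e).
    { replace (4 * L * e) with ((e - 0) * (4 * L)) by ring.
      apply abs_RInt_le_const; try lra. apply Hgex.
      intros t Ht. unfold g. rewrite Rabs_mult.
      generalize (HL t ltac:(lra)) (dirichlet_bound K t ltac:(lra)) (Rabs_pos (dirichlet K t)). nra. }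
    assert (H2 : Rabs (RInt (g K) e 1) < eps / 2).
    { rewrite (RInt_ext (g K) (fun t => (psi t - psi 0) / s t * sin (INR (S K) * PI * t))).
      2:{ intros t Ht. rewrite Rmin_left, Rmax_right in Ht by lra.
          rewrite <- dirichlet_sin.
          change ((psi t - psi 0) * dirichlet K t = (psi t - psi 0) / s t * (dirichlet K t * s t)).
          field.
          generalize (Hs t ltac:(lra)); lra. }
      assert (HK' : 2 * C / (PI * eps) < INR (S K)).
      { apply Rlt_le_trans with (1 := HN). rewrite S_INR. apply le_INR in HK. lra. }
      generalize PI_RGT_0; intros HP. assert (HKp : 0 < INR (S K)) by (apply lt_0_INR; lia).
      assert (Hom : 0 < INR (S K) * PI) by nra.
      apply Rle_lt_trans with (1 := HC _ Hom).
      apply Rmult_lt_reg_r with (INR (S K) * PI); trivial.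
      replace (C / (INR (S K) * PI) * (INR (S K) * PI)) with C by (field; lra).
      apply (Rmult_lt_compat_r (PI * eps)) in HK'. 2: nra.
      replace (2 * C / (PI * eps) * (PI * eps)) with (2 * C) in HK' by (field; lra). nra. }
    change (plus ?a ?b) with (a + b).
    apply Rle_lt_trans with (1 := Rabs_triang _ _). lra. }
  assert (Hl : is_lim_seq (fun K => RInt (g K) 0 1 + psi 0 * sum_n (fun j => 2 * ((-1) ^ j / pole j)) K) (psi 0)).
  { replace (Finite (psi 0)) with (Finite (0 + psi 0 * 1)) by (f_equal; ring).
    apply is_lim_seq_plus'; trivial.
    apply (is_lim_seq_scal_l _ (psi 0) 1). apply leibniz_pole. }
  revert Hl. apply is_lim_seq_ext. intros K.
  rewrite <- RInt_dirichlet. symmetry. apply is_RInt_unique.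
  apply (is_RInt_ext (fun t => plus (g K t) (scal (psi 0) (dirichlet K t)))).
  { intros t _. change ((psi t - psi 0) * dirichlet K t + psi 0 * dirichlet K t = psi t * dirichlet K t). ring. }
  apply (is_RInt_plus (g K)). { apply (RInt_correct (g K)), Hgex. }
  apply (is_RInt_scal (dirichlet K)). apply (RInt_correct (dirichlet K)).
  apply (ex_RInt_continuous (dirichlet K)). intros; apply dirichlet_continuous.
Qed.

(** * Partial fraction expansions of [tanh] and [1 / cosh], with explicit tails *)

Lemma sum_n_SR (f : nat -> R) (n : nat) : sum_n f (S n) = sum_n f n + f (S n).
Proof. exact (sum_Sn f n). Qed.

Definition tanh_partial (K : nat) (x : R) : R :=
  sum_n (fun j => 2 * x / (x ^ 2 + pole j ^ 2)) K.

Definition sech_partial (K : nat) (x : R) : R :=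
  sum_n (fun j => (-1) ^ j * (2 * pole j) / (x ^ 2 + pole j ^ 2)) K.

Lemma cosh_pos (x : R) : 0 < cosh x.
Proof. unfold cosh. generalize (exp_pos x) (exp_pos (- x)); lra. Qed.

Lemma sum_sq_pole_pos (x : R) (j : nat) : 0 < x ^ 2 + pole j ^ 2.
Proof. generalize (pole_pos j). nra. Qed.

Lemma RInt_mult_dirichlet (psi : R -> R) (v : nat -> R) (K : nat) :
  (forall j, is_RInt (fun t => psi t * (2 * cos (pole j * t))) 0 1 (v j)) ->
  RInt (fun t => psi t * dirichlet K t) 0 1 = sum_n v K.
Proof.
  intros H. apply is_RInt_unique.
  apply (is_RInt_ext (fun t => sum_n (fun j => psi t * (2 * cos (pole j * t))) K)).
  { intros t _. unfold dirichlet. apply (sum_n_mult_l (K := R_Ring)). }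
  now apply (is_RInt_sum_n (fun j t => psi t * (2 * cos (pole j * t)))).
Qed.

(** The function [cosh (x * t)] has value 1 at [t = 0], and its integral against
    [2 * cos (pole j * t)] is [cosh x] times the j-th term of the expansion, since
    [cos (pole j) = 0] and [sin (pole j) = (-1) ^ j]. *)
Lemma is_lim_sech_partial (x : R) : is_lim_seq (fun K => sech_partial K x) (/ cosh x).
Proof.
  assert (H := RInt_dirichlet_lim (fun t => cosh (x * t)) (fun t => x * sinh (x * t))).
  simpl in H. rewrite Rmult_0_r, cosh_0 in H.
  apply (is_lim_seq_scal_l _ (/ cosh x)) in H.
  - simpl in H. rewrite Rmult_1_r in H. revert H. apply is_lim_seq_ext. intros K.
    rewrite (RInt_mult_dirichlet (fun t => cosh (x * t))
       (fun j => cosh x * ((-1) ^ j * (2 * pole j) / (x ^ 2 + pole j ^ 2)))).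
    + unfold sech_partial. rewrite <- (sum_n_mult_l (K := R_Ring)). apply sum_n_ext. intros j.
      change (/ cosh x * (cosh x * ((-1) ^ j * (2 * pole j) / (x ^ 2 + pole j ^ 2))) =
        (-1) ^ j * (2 * pole j) / (x ^ 2 + pole j ^ 2)).
      field. split. apply Rgt_not_eq, sum_sq_pole_pos. apply Rgt_not_eq, cosh_pos.
    + intros j. generalize (sum_sq_pole_pos x j); intros Hp.
      destruct (cos_sin_pole j) as [Hc Hs].
      (* This primitive comes from integrating by parts twice and solving for the integral, which
         produces the denominator [x ^ 2 + pole j ^ 2]. *)
      set (F := fun t => 2 * (x * sinh (x * t) * cos (pole j * t) + pole j * cosh (x * t) * sin (pole j * t)) / (x ^ 2 + pole j ^ 2)).
      replace (cosh x * ((-1) ^ j * (2 * pole j) / (x ^ 2 + pole j ^ 2))) with (F 1 - F 0).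
      * apply (is_RInt_derive F (fun t => cosh (x * t) * (2 * cos (pole j * t)))); intros t _.
        -- unfold F, sinh, cosh. auto_derive; trivial. field. lra.
        -- apply (ex_derive_continuous (fun t => cosh (x * t) * (2 * cos (pole j * t)))).
           unfold cosh. auto_derive; trivial.
      * unfold F. rewrite !Rmult_1_r, !Rmult_0_r, Hc, Hs, sin_0, sinh_0. field. lra.
  - intros t. unfold cosh, sinh. auto_derive; trivial. field.
  - intros t. apply (ex_derive_continuous (fun t => x * sinh (x * t))). unfold sinh. auto_derive; trivial.
Qed.

(** Here the test function [sinh (x * (1 - t))] vanishes at [t = 1] and equals [sinh x] at [t = 0],
    so only the endpoint 0 contributes [2 * x * cosh x / (x ^ 2 + pole j ^ 2)], with no alternating
    sign. *)
Lemma is_lim_tanh_partial (x : R) : is_lim_seq (fun K => tanh_partial K x) (tanh x).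
Proof.
  assert (H := RInt_dirichlet_lim (fun t => sinh (x * (1 - t))) (fun t => - x * cosh (x * (1 - t)))).
  simpl in H. rewrite Rminus_0_r, Rmult_1_r in H.
  apply (is_lim_seq_scal_l _ (/ cosh x)) in H.
  - simpl in H. replace (/ cosh x * sinh x) with (tanh x) in H
      by (unfold tanh; field; apply Rgt_not_eq, cosh_pos).
    revert H. apply is_lim_seq_ext. intros K.
    rewrite (RInt_mult_dirichlet (fun t => sinh (x * (1 - t)))
       (fun j => cosh x * (2 * x / (x ^ 2 + pole j ^ 2)))).
    + unfold tanh_partial. rewrite <- (sum_n_mult_l (K := R_Ring)). apply sum_n_ext. intros j.
      change (/ cosh x * (cosh x * (2 * x / (x ^ 2 + pole j ^ 2))) = 2 * x / (x ^ 2 + pole j ^ 2)).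
      field. split. apply Rgt_not_eq, sum_sq_pole_pos. apply Rgt_not_eq, cosh_pos.
    + intros j. generalize (sum_sq_pole_pos x j); intros Hp.
      destruct (cos_sin_pole j) as [Hc Hs].
      set (F := fun t => 2 * (- x * cosh (x * (1 - t)) * cos (pole j * t) + pole j * sinh (x * (1 - t)) * sin (pole j * t)) / (x ^ 2 + pole j ^ 2)).
      replace (cosh x * (2 * x / (x ^ 2 + pole j ^ 2))) with (F 1 - F 0).
      * apply (is_RInt_derive F (fun t => sinh (x * (1 - t)) * (2 * cos (pole j * t)))); intros t _.
        -- unfold F, sinh, cosh, Rminus. auto_derive; trivial. field. lra.
        -- apply (ex_derive_continuous (fun t => sinh (x * (1 - t)) * (2 * cos (pole j * t)))).
           unfold sinh. auto_derive; trivial.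
      * unfold F. rewrite Rminus_diag, Rminus_0_r, !Rmult_1_r, !Rmult_0_r, Hc, Hs, sin_0, sinh_0, cos_0. field. lra.
  - intros t. unfold cosh, sinh, Rminus. auto_derive; trivial. field.
  - intros t. apply (ex_derive_continuous (fun t => - x * cosh (x * (1 - t)))). unfold cosh. auto_derive; trivial.
Qed.

(** Steps of length two are used because the expansion of [1 / cosh] converges only conditionally:
    its increments decay like [1 / j ^ 2] only after consecutive terms are paired. The bounds
    telescope along [k, k + 2, k + 4, ...], and this subsequence has the same limit. *)
Lemma tail_le_telescope (s : nat -> R) (l C : R) (k : nat) :
  is_lim_seq s l ->
  (forall j, Rabs (s (S (S j)) - s j) <= C * (/ INR (S j) - / INR (S (S (S j))))) ->
  Rabs (l - s k) <= C / INR (S k).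
Proof.
  intros Hl Hs.
  assert (HC : 0 <= C).
  { generalize (Rle_trans _ _ _ (Rabs_pos _) (Hs 0%nat)). simpl INR. intros. nra. }
  assert (H : forall L, Rabs (s (k + 2 * L)%nat - s k) <= C * (/ INR (S k) - / INR (S (k + 2 * L)))).
  { induction L as [|L IH].
    - replace (k + 2 * 0)%nat with k by lia. rewrite Rminus_diag, Rabs_R0. lra.
    - replace (k + 2 * S L)%nat with (S (S (k + 2 * L))) by lia.
      generalize (Hs (k + 2 * L)%nat); intros H.
      replace (s (S (S (k + 2 * L))) - s k) with
        ((s (S (S (k + 2 * L))) - s (k + 2 * L)%nat) + (s (k + 2 * L)%nat - s k)) by ring.
      apply Rle_trans with (1 := Rabs_triang _ _). lra. }
  assert (Hb : forall L, Rabs (s (k + 2 * L)%nat - s k) <= C / INR (S k)).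
  { intros L. apply Rle_trans with (1 := H L). unfold Rdiv. apply Rmult_le_compat_l; trivial.
    assert (0 < / INR (S (k + 2 * L))) by (apply Rinv_0_lt_compat, lt_0_INR; lia). lra. }
  assert (Hsub : is_lim_seq (fun L => Rabs (s (k + 2 * L)%nat - s k)) (Rabs (l - s k))).
  { apply (is_lim_seq_abs _ (l - s k)). apply is_lim_seq_minus'; [|apply is_lim_seq_const].
    apply (is_lim_seq_subseq s l (fun L => (k + 2 * L)%nat)); trivial.
    apply eventually_subseq. intros n. lia. }
  exact (is_lim_seq_le _ _ _ (C / INR (S k)) Hb Hsub (is_lim_seq_const _)).
Qed.

(** The reason is [(j + 3/2)^2 >= (j + 1) (j + 2)], whose right side has a telescoping
    reciprocal. *)
Lemma inv_sq_pole_le (j : nat) :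
  / pole (S j) ^ 2 <= / PI ^ 2 * (/ INR (S j) - / INR (S (S j))).
Proof.
  generalize PI_RGT_0 (pos_INR j). intros HP Hj.
  rewrite !S_INR.
  replace (/ PI ^ 2 * (/ (INR j + 1) - / (INR j + 1 + 1))) with
    (/ (PI ^ 2 * ((INR j + 1) * (INR j + 1 + 1)))) by (field; lra).
  unfold pole. rewrite S_INR. apply Rinv_le_contravar.
  - apply Rmult_lt_0_compat; nra.
  - replace ((PI * (INR j + 1 + 1 / 2)) ^ 2) with (PI ^ 2 * (INR j + 1 + 1 / 2) ^ 2) by ring.
    apply Rmult_le_compat_l; nra.
Qed.

(** The growth in [x] is compensated later by [ire_odd_bound], which gains a factor [x]. *)
Lemma tanh_partial_tail (x : R) (K : nat) : 0 < x ->
  Rabs (tanh x - tanh_partial K x) <= 2 * x / INR (S K).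
Proof.
  intros Hx. apply (tail_le_telescope (fun K => tanh_partial K x)). apply is_lim_tanh_partial.
  intros j. unfold tanh_partial. rewrite !sum_n_SR.
  match goal with |- Rabs (?a + ?b + ?c - ?a) <= _ => replace (a + b + c - a) with (b + c) by ring end.
  assert (HP : / PI ^ 2 <= 1).
  { rewrite <- Rinv_1. apply Rinv_le_contravar. lra. generalize PI2_1; nra. }
  assert (H : forall i, 0 <= 2 * x / (x ^ 2 + pole (S i) ^ 2) <= 2 * x * (/ INR (S i) - / INR (S (S i)))).
  { intros i. generalize (sum_sq_pole_pos x (S i)) (pole_pos (S i)). intros H1 H2. split.
    - apply Rlt_le, Rdiv_lt_0_compat; lra.
    - unfold Rdiv. apply Rmult_le_compat_l. lra.
      apply Rle_trans with (/ pole (S i) ^ 2). apply Rinv_le_contravar; nra.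
      apply Rle_trans with (1 := inv_sq_pole_le i).
      rewrite <- (Rmult_1_l (_ - _)) at 2. apply Rmult_le_compat_r; trivial.
      assert (/ INR (S (S i)) <= / INR (S i)).
      { apply Rinv_le_contravar. apply lt_0_INR; lia. apply le_INR; lia. } lra. }
  rewrite Rabs_right; generalize (H j) (H (S j)); lra.
Qed.

Lemma sech_partial_tail (x : R) (K : nat) :
  Rabs (/ cosh x - sech_partial K x) <= 2 * PI / INR (S K).
Proof.
  apply (tail_le_telescope (fun K => sech_partial K x)). apply is_lim_sech_partial.
  intros j. unfold sech_partial. rewrite !sum_n_SR.
  match goal with |- Rabs (?a + ?b + ?c - ?a) <= _ => replace (a + b + c - a) with (b + c) by ring end.
  rewrite (pole_S (S j)).
  assert (HP : / PI ^ 2 <= 1).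
  { rewrite <- Rinv_1. apply Rinv_le_contravar. lra. generalize PI2_1; nra. }
  generalize PI_RGT_0 (pole_pos (S j)) (inv_sq_pole_le j); intros Hpi Hp Hq.
  assert (Hpos : / INR (S (S (S j))) <= / INR (S (S j)) <= / INR (S j)).
  { split; (apply Rinv_le_contravar; [apply lt_0_INR; lia | apply le_INR; lia]). }
  assert (Hb : / pole (S j) ^ 2 <= / INR (S j) - / INR (S (S (S j)))).
  { apply Rle_trans with (1 := Hq).
    apply Rle_trans with (1 * (/ INR (S j) - / INR (S (S j)))). apply Rmult_le_compat_r; lra. lra. }
  apply Rle_trans with (2 * PI * / pole (S j) ^ 2). 2: apply Rmult_le_compat_l; lra.
  set (a := pole (S j)) in *. set (b := a + PI).
  assert (D1 : 0 < x ^ 2 + a ^ 2) by nra. assert (D2 : 0 < x ^ 2 + b ^ 2) by (unfold b; nra).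
  (* Pairing leaves the numerator [a * b - x ^ 2], of absolute value at most [x ^ 2 + b ^ 2]. One
     denominator therefore cancels and the other is at least [a ^ 2], uniformly in [x]. *)
  assert (E : (-1) ^ S j * (2 * a) / (x ^ 2 + a ^ 2) + (-1) ^ S (S j) * (2 * b) / (x ^ 2 + b ^ 2)
     = (-1) ^ S j * (2 * PI * ((a * b - x ^ 2) / (x ^ 2 + b ^ 2) * / (x ^ 2 + a ^ 2)))).
  { replace ((-1) ^ S (S j)) with (- (-1) ^ S j) by (simpl; ring).
    generalize ((-1) ^ S j); intros r. unfold b in *. field. lra. }
  rewrite E, Rabs_mult, pow_1_abs, Rmult_1_l, Rabs_mult, (Rabs_right (2 * PI)) by lra.
  apply Rmult_le_compat_l. lra.
  assert (Hi : / (x ^ 2 + a ^ 2) <= / a ^ 2) by (apply Rinv_le_contravar; nra).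
  assert (Hi0 : 0 < / (x ^ 2 + a ^ 2)) by now apply Rinv_0_lt_compat.
  rewrite Rabs_mult, (Rabs_right (/ _)) by lra.
  apply Rle_trans with (2 := Hi). rewrite <- (Rmult_1_l (/ (x ^ 2 + a ^ 2))) at 2.
  apply Rmult_le_compat_r. lra.
  unfold Rdiv. rewrite Rabs_mult, (Rabs_right (/ _)) by (generalize (Rinv_0_lt_compat _ D2); lra).
  apply (Rmult_le_reg_r (x ^ 2 + b ^ 2)); trivial.
  rewrite Rmult_assoc, Rinv_l, Rmult_1_r, Rmult_1_l by lra.
  apply Rabs_le. unfold b. nra.
Qed.

(** * Real and imaginary parts of the powers [(x + i y)^-N] *)

Definition ipow (y : R) (N : nat) (x : R) : C := (Cpow (Cinv (x, y)) N).

Definition ire (y : R) (N : nat) (x : R) : R := Re (ipow y N x).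

Definition iim (y : R) (N : nat) (x : R) : R := Im (ipow y N x).

Lemma ire_S (y x : R) (N : nat) : 0 < y ->
  ire y (S N) x = (x * ire y N x + y * iim y N x) / (x ^ 2 + y ^ 2).
Proof.
  intros Hy. unfold ire, iim, ipow. rewrite Cpow_S.
  destruct (Cpow (Cinv (x, y)) N) as [p q]. simpl. field. nra.
Qed.

Lemma iim_S (y x : R) (N : nat) : 0 < y ->
  iim y (S N) x = (x * iim y N x - y * ire y N x) / (x ^ 2 + y ^ 2).
Proof.
  intros Hy. unfold ire, iim, ipow. rewrite Cpow_S.
  destruct (Cpow (Cinv (x, y)) N) as [p q]. simpl. field. nra.
Qed.

(** Both parts go through one induction on [N], because [ire_S] and [iim_S] mix them. *)
Lemma is_derive_ipow (y : R) (N : nat) (x : R) : 0 < y ->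
  is_derive (ire y N) x (- INR N * ire y (S N) x) /\
  is_derive (iim y N) x (- INR N * iim y (S N) x).
Proof.
  intros Hy. induction N as [|N [IHr IHi]].
  - simpl INR. split; (replace (_ * _) with 0 by ring).
    + apply (is_derive_ext (fun _ => 1)). reflexivity. apply (is_derive_const (V := R_NormedModule)).
    + apply (is_derive_ext (fun _ => 0)). reflexivity. apply (is_derive_const (V := R_NormedModule)).
  - assert (Hn : x ^ 2 + y ^ 2 <> 0) by nra.
    rewrite S_INR.
    split.
    + apply (is_derive_ext (fun x => (x * ire y N x + y * iim y N x) / (x ^ 2 + y ^ 2))).
      { intros t. now rewrite ire_S. }
      auto_derive. { repeat split; trivial; eexists; eassumption. }
      replace (Derive (fun x => ire y N x) x) with (- INR N * ire y (S N) x)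
        by (symmetry; now apply is_derive_unique).
      replace (Derive (fun x => iim y N x) x) with (- INR N * iim y (S N) x)
        by (symmetry; now apply is_derive_unique).
      repeat (rewrite ?ire_S, ?iim_S by trivial). field. trivial.
    + apply (is_derive_ext (fun x => (x * iim y N x - y * ire y N x) / (x ^ 2 + y ^ 2))).
      { intros t. now rewrite iim_S. }
      auto_derive. { repeat split; trivial; eexists; eassumption. }
      replace (Derive (fun x => ire y N x) x) with (- INR N * ire y (S N) x)
        by (symmetry; now apply is_derive_unique).
      replace (Derive (fun x => iim y N x) x) with (- INR N * iim y (S N) x)
        by (symmetry; now apply is_derive_unique).
      repeat (rewrite ?ire_S, ?iim_S by trivial). field. trivial.
Qed.

Lemma ire_continuous (y : R) (N : nat) (x : R) : 0 < y -> continuous (ire y N) x.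
Proof.
  intros Hy. apply (ex_derive_continuous (ire y N)).
  exists (- INR N * ire y (S N) x). exact (proj1 (is_derive_ipow y N x Hy)).
Qed.

Lemma iim_continuous (y : R) (N : nat) (x : R) : 0 < y -> continuous (iim y N) x.
Proof.
  intros Hy. apply (ex_derive_continuous (iim y N)).
  exists (- INR N * iim y (S N) x). exact (proj2 (is_derive_ipow y N x Hy)).
Qed.

(** At [x = 0] the power is [(i y)^-N], real for even [N] and purely imaginary for odd [N]. This
    removes the boundary terms at 0 in the integrations below. *)
Lemma ipow_0 (y : R) (k : nat) : 0 < y ->
  iim y (2 * k) 0 = 0 /\ ire y (2 * k + 1) 0 = 0.
Proof.
  intros Hy.
  assert (H : forall N, iim y N 0 = 0 -> ire y (N + 1) 0 = 0).
  { intros N H. rewrite Nat.add_1_r, ire_S, H by trivial. field. lra. }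
  induction k as [|k [IHi IHr]].
  - split; [reflexivity | apply H; reflexivity].
  - assert (Hi : iim y (2 * S k) 0 = 0).
    { replace (2 * S k)%nat with (S (2 * k + 1)) by lia. rewrite iim_S, IHr by trivial. field. lra. }
    split; [|apply H]; trivial.
Qed.

Lemma Cmod_Cinv_sq (x y : R) : 0 < y -> (Cmod (Cinv (x, y))) ^ 2 = / (x ^ 2 + y ^ 2).
Proof.
  intros Hy. rewrite Cmod_inv.
  - rewrite pow_inv. f_equal. unfold Cmod. simpl fst; simpl snd.
    rewrite pow2_sqrt; nra.
  - intros E. injection E. lra.
Qed.

Lemma ire_le_Cmod (y : R) (N : nat) (x : R) : Rabs (ire y N x) <= Cmod (Cinv (x, y)) ^ N.
Proof. unfold ire, ipow. rewrite <- Cmod_pow. apply re_le_Cmod. Qed.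

Lemma iim_le_Cmod (y : R) (N : nat) (x : R) : Rabs (iim y N x) <= Cmod (Cinv (x, y)) ^ N.
Proof.
  unfold iim, ipow. rewrite <- Cmod_pow.
  apply Rle_trans with (2 := Rmax_Cmod _). apply Rmax_r.
Qed.

Lemma Cmod_Cinv_le (x y : R) : 0 < y -> 0 < x -> x * Cmod (Cinv (x, y)) <= 1.
Proof.
  intros Hy Hx. generalize (Cmod_Cinv_sq x y Hy) (Cmod_ge_0 (Cinv (x, y))).
  set (c := Cmod _). intros H H0.
  assert (c ^ 2 * (x ^ 2 + y ^ 2) = 1) by (rewrite H; field; nra).
  assert ((x * c) ^ 2 <= 1) by nra. nra.
Qed.

Lemma ire_even_bound (y x : R) (k : nat) : 0 < y -> 0 < x ->
  Rabs (ire y (2 * k) x) <= / (x ^ 2 + y ^ 2) ^ k.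
Proof.
  intros Hy Hx. apply Rle_trans with (1 := ire_le_Cmod _ _ _).
  rewrite pow_mult, Cmod_Cinv_sq, pow_inv by trivial. lra.
Qed.

(** The odd factor is absorbed by [x <= Cmod (x, y)], which leaves an even power. *)
Lemma ire_odd_bound (y x : R) (k : nat) : 0 < y -> 0 < x ->
  x * Rabs (ire y (2 * k + 1) x) <= / (x ^ 2 + y ^ 2) ^ k.
Proof.
  intros Hy Hx.
  apply Rle_trans with (x * (Cmod (Cinv (x, y)) ^ (2 * k + 1))).
  { apply Rmult_le_compat_l. lra. apply ire_le_Cmod. }
  rewrite pow_add, pow_mult, Cmod_Cinv_sq, pow_inv, pow_1 by trivial.
  generalize (Cmod_Cinv_le x y Hy Hx). intros H.
  assert (0 < / (x ^ 2 + y ^ 2) ^ k) by (apply Rinv_0_lt_compat, pow_lt; nra). nra.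
Qed.

Lemma filterlim_at_right_0 (F : R -> R) (v : R) : continuous F 0 -> F 0 = v ->
  filterlim F (at_right 0) (locally v).
Proof.
  intros H <-. apply filterlim_filter_le_1 with (2 := H). apply filter_le_within.
Qed.

Lemma filterlim_p_infty_0 (F : R -> R) (C : R) :
  (forall x, 1 < x -> Rabs (F x) <= C / x) ->
  filterlim F (Rbar_locally p_infty) (locally 0).
Proof.
  intros H. apply filterlim_locally. intros eps.
  exists (Rmax 1 (C / eps)). intros x Hx.
  generalize (Rmax_l 1 (C / eps)) (Rmax_r 1 (C / eps)) (cond_pos eps); intros H1 H2 He.
  unfold ball; simpl; unfold AbsRing_ball, abs, minus, plus, opp; simpl.
  rewrite Ropp_0, Rplus_0_r. apply Rle_lt_trans with (1 := H x ltac:(lra)).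
  apply Rmult_lt_reg_r with x. lra. unfold Rdiv. rewrite Rmult_assoc, Rinv_l by lra.
  apply Rmult_lt_reg_r with (/ eps). now apply Rinv_0_lt_compat.
  replace (eps * x * / eps) with x by (field; lra). rewrite Rmult_1_r. unfold Rdiv in *. lra.
Qed.

Lemma Cmod_Cinv_pow_le (x y : R) (N : nat) : 0 < y -> 1 < x ->
  Cmod (Cinv (x, y)) ^ S N <= 1 / x.
Proof.
  intros Hy Hx. generalize (Cmod_Cinv_le x y Hy ltac:(lra)) (Cmod_ge_0 (Cinv (x, y))).
  set (c := Cmod _). intros H H0.
  assert (Hc : c <= 1 / x).
  { apply Rmult_le_reg_r with x. lra. unfold Rdiv. rewrite Rmult_assoc, Rinv_l; lra. }
  assert (1 / x <= 1). { unfold Rdiv. rewrite Rmult_1_l, <- Rinv_1. apply Rinv_le_contravar; lra. }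
  assert (c ^ N <= 1). { rewrite <- (pow1 N). apply pow_incr. lra. }
  simpl. assert (0 <= c ^ N) by (now apply pow_le). nra.
Qed.

Lemma filterlim_ire_p_infty (y : R) (N : nat) : 0 < y ->
  filterlim (ire y (S N)) (Rbar_locally p_infty) (locally 0).
Proof.
  intros Hy. apply filterlim_p_infty_0 with 1. intros x Hx.
  apply Rle_trans with (1 := ire_le_Cmod _ _ _). now apply Cmod_Cinv_pow_le.
Qed.

Lemma filterlim_iim_p_infty (y : R) (N : nat) : 0 < y ->
  filterlim (iim y (S N)) (Rbar_locally p_infty) (locally 0).
Proof.
  intros Hy. apply filterlim_p_infty_0 with 1. intros x Hx.
  apply Rle_trans with (1 := iim_le_Cmod _ _ _). now apply Cmod_Cinv_pow_le.
Qed.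

(** Up to a constant the primitive is [ire y (2 * k + 1)], an odd power: it vanishes at 0 by
    [ipow_0] and at infinity by decay. The imaginary analogue below needs an odd exponent for the
    same reason. *)
Lemma is_RInt_pos_ire (y : R) (k : nat) : 0 < y -> is_RInt_pos (ire y (2 * k + 2)) 0.
Proof.
  intros Hy. generalize (lt_0_INR (2 * k + 1) ltac:(lia)); intros HN.
  destruct (ipow_0 y k Hy) as [_ H0].
  replace 0 with (- / INR (2 * k + 1) * (0 - 0)) by ring.
  apply is_RInt_pos_ext with (fun x => - / INR (2 * k + 1) * (- INR (2 * k + 1) * ire y (S (2 * k + 1)) x)).
  { intros x _. replace (2 * k + 2)%nat with (S (2 * k + 1)) by lia. field. lra. }
  apply is_RInt_pos_scal. apply (is_RInt_pos_derive (ire y (2 * k + 1))).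
  - intros x _. exact (proj1 (is_derive_ipow y (2 * k + 1) x Hy)).
  - intros x _. apply (continuous_scal_r (- INR (2 * k + 1)) (ire y (S (2 * k + 1)))). now apply ire_continuous.
  - apply filterlim_at_right_0; trivial. now apply ire_continuous.
  - rewrite Nat.add_1_r. now apply filterlim_ire_p_infty.
Qed.

Lemma is_RInt_pos_iim (y : R) (k : nat) : 0 < y -> is_RInt_pos (iim y (2 * k + 3)) 0.
Proof.
  intros Hy. generalize (lt_0_INR (2 * S k) ltac:(lia)); intros HN.
  destruct (ipow_0 y (S k) Hy) as [H0 _].
  replace 0 with (- / INR (2 * S k) * (0 - 0)) by ring.
  apply is_RInt_pos_ext with (fun x => - / INR (2 * S k) * (- INR (2 * S k) * iim y (S (2 * S k)) x)).
  { intros x _. replace (2 * k + 3)%nat with (S (2 * S k)) by lia. field. lra. }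
  apply is_RInt_pos_scal. apply (is_RInt_pos_derive (iim y (2 * S k))).
  - intros x _. exact (proj2 (is_derive_ipow y (2 * S k) x Hy)).
  - intros x _. apply (continuous_scal_r (- INR (2 * S k)) (iim y (S (2 * S k)))). now apply iim_continuous.
  - apply filterlim_at_right_0; trivial. now apply iim_continuous.
  - replace (2 * S k)%nat with (S (2 * k + 1)) by lia. now apply filterlim_iim_p_infty.
Qed.

Lemma filterlim_atan_div (c : R) : 0 < c ->
  filterlim (fun x => atan (x / c)) (Rbar_locally p_infty) (locally (PI / 2)).
Proof.
  intros Hc.
  apply filterlim_ext_loc with (fun x => PI / 2 - atan (c * / x)).
  { exists 0. intros x Hx. replace (c * / x) with (/ (x / c)) by (field; lra).
    rewrite atan_inv by (apply Rdiv_lt_0_compat; lra). ring. }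
  apply (filterlim_comp _ _ _ (fun x => c * / x) (fun u => PI / 2 - atan u) _ (locally 0)).
  - apply filterlim_p_infty_0 with c. intros x Hx.
    rewrite Rabs_right. apply Rle_refl. apply Rle_ge, Rlt_le, Rdiv_lt_0_compat; lra.
  - assert (H : continuous (fun u => PI / 2 - atan u) 0).
    { apply (ex_derive_continuous (fun u => PI / 2 - atan u)). auto_derive; trivial. }
    unfold continuous in H. now rewrite atan_0, Rminus_0_r in H.
Qed.

(** The jump of this value as [c] changes sign is the only source of the distinction between poles
    above and below the real axis. *)
Lemma is_RInt_pos_atan (c : R) : c <> 0 ->
  is_RInt_pos (fun x => c / (x ^ 2 + c ^ 2)) (if Rlt_dec 0 c then PI / 2 else - (PI / 2)).
Proof.
  assert (H : forall c, 0 < c -> is_RInt_pos (fun x => c / (x ^ 2 + c ^ 2)) (PI / 2)).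
  { clear c. intros c Hc. replace (PI / 2) with (PI / 2 - 0) by ring.
    apply (is_RInt_pos_derive (fun x => atan (x / c))).
    - intros x _. auto_derive; trivial. field. split; nra.
    - intros x _. apply (ex_derive_continuous (fun x => c / (x ^ 2 + c ^ 2))). auto_derive. nra.
    - apply (filterlim_at_right_0 (fun x => atan (x / c))).
      apply (ex_derive_continuous (fun x => atan (x / c))). auto_derive; trivial.
      unfold Rdiv. now rewrite Rmult_0_l, atan_0.
    - now apply filterlim_atan_div. }
  intros Hc. destruct (Rlt_dec 0 c) as [Hp|Hn]; [auto|].
  replace (- (PI / 2)) with (-1 * (PI / 2)) by ring.
  apply is_RInt_pos_ext with (fun x => -1 * (- c / (x ^ 2 + (- c) ^ 2))).
  { intros x Hx. field. nra. }
  apply is_RInt_pos_scal. apply H. lra.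
Qed.

(** * Contribution of a single pole *)

Definition kre (c y : R) (N : nat) (x : R) : R :=
  (x * ire y N x - c * iim y N x) / (x ^ 2 + c ^ 2).

Definition kim (c y : R) (N : nat) (x : R) : R :=
  (x * iim y N x + c * ire y N x) / (x ^ 2 + c ^ 2).

(** With [z = x + i y] one has [z - (x - i c) = i (c + y)], so [z^-(N+1) / (x - i c)] is
    [- i / (c + y)] times the difference of [z^-N / (x - i c)] and [z^-(N+1)]. The factor [- i]
    exchanges real and imaginary parts. *)
Lemma kre_S (c y : R) (N : nat) (x : R) : 0 < y -> 0 < x -> c + y <> 0 ->
  kre c y (S N) x = / (c + y) * (kim c y N x - iim y (S N) x).
Proof.
  intros Hy Hx Hc. unfold kre, kim. rewrite !ire_S, !iim_S by trivial. field.
  repeat split; trivial; nra.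
Qed.

Lemma kim_S (c y : R) (N : nat) (x : R) : 0 < y -> 0 < x -> c + y <> 0 ->
  kim c y (S N) x = - / (c + y) * (kre c y N x - ire y (S N) x).
Proof.
  intros Hy Hx Hc. unfold kre, kim. rewrite !ire_S, !iim_S by trivial. field.
  repeat split; trivial; nra.
Qed.

(* [kre + i kim] is [(x + i y)^-N / (x - i c)]: the residue at [i c] contributes
   only for [c > 0], and partial fractions in [x] lower [N]. *)
Lemma is_RInt_pos_kernel (c y : R) (k : nat) : 0 < y -> c <> 0 -> c + y <> 0 ->
  let B := if Rlt_dec 0 c then PI else 0 in
  is_RInt_pos (kre c y (2 * k + 1)) ((-1) ^ k * B / (c + y) ^ (2 * k + 1)) /\
  is_RInt_pos (kim c y (2 * k + 2)) ((-1) ^ S k * B / (c + y) ^ (2 * k + 2)).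
Proof.
  intros Hy Hc Hcy B.
  (* The induction alternates between [kre] at odd and [kim] at even exponents, because the
     correction terms are then [ire] at even and [iim] at odd exponents, whose integrals vanish. *)
  assert (Hstep : forall k v, is_RInt_pos (kre c y (2 * k + 1)) v ->
            is_RInt_pos (kim c y (2 * k + 2)) (- / (c + y) * (v - 0))).
  { intros j v H. apply is_RInt_pos_ext with
      (fun x => - / (c + y) * (kre c y (2 * j + 1) x - ire y (2 * j + 2) x)).
    - intros x Hx. replace (2 * j + 2)%nat with (S (2 * j + 1)) by lia. now rewrite kim_S.
    - apply is_RInt_pos_scal, is_RInt_pos_minus; trivial. now apply is_RInt_pos_ire. }
  induction k as [|k [_ IHi]].
  - assert (H : is_RInt_pos (kre c y (2 * 0 + 1)) ((-1) ^ 0 * B / (c + y) ^ (2 * 0 + 1))).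
    (* The two arctangents contribute [PI / 2] with the sign of [c] and [PI / 2] with the sign of
       [y]; their sum is [B]. *)
    { apply is_RInt_pos_ext with (fun x => / (c + y) * (c / (x ^ 2 + c ^ 2) + y / (x ^ 2 + y ^ 2))).
      - intros x Hx. change (2 * 0 + 1)%nat with 1%nat. unfold kre. rewrite ire_S, iim_S by trivial.
        change (ire y 0 x) with 1. change (iim y 0 x) with 0. field. repeat split; trivial; nra.
      - replace ((-1) ^ 0 * B / (c + y) ^ (2 * 0 + 1)) with
          (/ (c + y) * ((if Rlt_dec 0 c then PI / 2 else - (PI / 2)) + PI / 2)).
        + apply is_RInt_pos_scal, is_RInt_pos_plus. now apply is_RInt_pos_atan.
          generalize (is_RInt_pos_atan y ltac:(lra)). now destruct (Rlt_dec 0 y).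
        + unfold B. simpl. destruct (Rlt_dec 0 c); field; trivial. }
    split; trivial. apply Hstep in H. revert H.
    match goal with |- is_RInt_pos _ ?u -> is_RInt_pos _ ?v => replace u with v; trivial end.
    simpl. field. trivial.
  - assert (H : is_RInt_pos (kre c y (2 * S k + 1)) ((-1) ^ S k * B / (c + y) ^ (2 * S k + 1))).
    { apply is_RInt_pos_ext with (fun x => / (c + y) * (kim c y (2 * k + 2) x - iim y (2 * k + 3) x)).
      - intros x Hx. replace (2 * k + 3)%nat with (S (2 * k + 2)) by lia.
        replace (2 * S k + 1)%nat with (S (2 * k + 2)) by lia. now rewrite kre_S.
      - replace ((-1) ^ S k * B / (c + y) ^ (2 * S k + 1)) with
          (/ (c + y) * ((-1) ^ S k * B / (c + y) ^ (2 * k + 2) - 0)).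
        + apply is_RInt_pos_scal, is_RInt_pos_minus; trivial. now apply is_RInt_pos_iim.
        + replace (2 * S k + 1)%nat with (S (2 * k + 2)) by lia.
          rewrite <- (tech_pow_Rmult (c + y)). field. split; trivial. now apply pow_nonzero. }
    split; trivial. apply Hstep in H. revert H.
    match goal with |- is_RInt_pos _ ?u -> is_RInt_pos _ ?v => replace u with v; trivial end.
    replace (2 * S k + 2)%nat with (S (2 * S k + 1)) by lia.
    rewrite <- (tech_pow_Rmult (c + y)), <- !(tech_pow_Rmult (-1)). field. split; trivial. now apply pow_nonzero.
Qed.

(** The factor [2 x / (x^2 + a^2)] is [1 / (x - i a) + 1 / (x + i a)], and only the first summand
    has a nonzero integral. The condition [y < a] keeps [- a + y] away from 0. *)
Lemma is_RInt_pos_pole_odd (a y : R) (k : nat) : 0 < y < a ->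
  is_RInt_pos (fun x => 2 * x / (x ^ 2 + a ^ 2) * ire y (2 * k + 1) x)
    ((-1) ^ k * PI / (a + y) ^ (2 * k + 1)).
Proof.
  intros Hy.
  destruct (is_RInt_pos_kernel a y k) as [H1 _]; try lra.
  destruct (is_RInt_pos_kernel (- a) y k) as [H2 _]; try lra.
  destruct (Rlt_dec 0 a); try lra. destruct (Rlt_dec 0 (- a)); try lra.
  generalize (is_RInt_pos_plus _ _ _ _ H1 H2). unfold Rdiv. rewrite Rmult_0_r, Rmult_0_l, Rplus_0_r.
  apply is_RInt_pos_ext. intros x Hx. unfold kre. field. nra.
Qed.

(** Here the imaginary part of the difference [1 / (x - i a) - 1 / (x + i a) = 2 i a / (x^2 + a^2)],
    times the power, is what appears. *)
Lemma is_RInt_pos_pole_even (a y : R) (k : nat) : 0 < y < a ->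
  is_RInt_pos (fun x => 2 * a / (x ^ 2 + a ^ 2) * ire y (2 * k + 2) x)
    ((-1) ^ S k * PI / (a + y) ^ (2 * k + 2)).
Proof.
  intros Hy.
  destruct (is_RInt_pos_kernel a y k) as [_ H1]; try lra.
  destruct (is_RInt_pos_kernel (- a) y k) as [_ H2]; try lra.
  destruct (Rlt_dec 0 a); try lra. destruct (Rlt_dec 0 (- a)); try lra.
  generalize (is_RInt_pos_minus _ _ _ _ H1 H2). unfold Rdiv. rewrite Rmult_0_r, Rmult_0_l, Rminus_0_r.
  apply is_RInt_pos_ext. intros x Hx. unfold kim. field. nra.
Qed.

Lemma is_RInt_pos_sum_n (f : nat -> R -> R) (l : nat -> R) (K : nat) :
  (forall j, is_RInt_pos (f j) (l j)) ->
  is_RInt_pos (fun t => sum_n (fun j => f j t) K) (sum_n l K).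
Proof.
  intros H. induction K as [|K IH].
  - rewrite sum_O. apply (is_RInt_pos_ext (f 0%nat)); trivial. intros t _. now rewrite sum_O.
  - rewrite sum_n_SR. apply (is_RInt_pos_ext (fun t => sum_n (fun j => f j t) K + f (S K) t)).
    { intros t _. now rewrite sum_n_SR. }
    now apply is_RInt_pos_plus.
Qed.

(** * Summation over the poles: regularised moments of [tanh] and [1 / cosh] *)

(** In terms of the Lerch transcendent this is [PI^-s Phi(q, s, 1/2 + y / PI)]. *)
Definition pole_zeta (q y : R) (s : nat) : R :=
  Series (fun j => q ^ j / (pole j + y) ^ s).

Lemma ex_series_inv_sq_pole : ex_series (fun j => / pole j ^ 2).
Proof.
  apply (ex_series_incr_1 (fun j => / pole j ^ 2)).
  apply (ex_series_le (V := R_CompleteNormedModule)) with (fun j => / INR (S j) - / INR (S (S j))).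
  - intros j. change (norm (/ pole (S j) ^ 2)) with (Rabs (/ pole (S j) ^ 2)).
    generalize (pole_pos (S j)) (inv_sq_pole_le j) PI2_1; intros Hp H HP.
    rewrite Rabs_right by (apply Rle_ge, Rlt_le, Rinv_0_lt_compat; nra).
    apply Rle_trans with (1 := H).
    assert (/ INR (S (S j)) <= / INR (S j)) by (apply Rinv_le_contravar; [apply lt_0_INR; lia | apply le_INR; lia]).
    assert (/ PI ^ 2 <= 1) by (rewrite <- Rinv_1; apply Rinv_le_contravar; nra). nra.
  - exists 1. change (is_lim_seq (sum_n (fun j => / INR (S j) - / INR (S (S j)))) 1).
    apply is_lim_seq_ext with (fun n => 1 - / INR (S (S n))).
    + intros n. induction n as [|n IH]. rewrite sum_O. simpl. field. rewrite sum_n_SR, <- IH. ring.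
    + replace (Finite 1) with (Finite (1 - 0)) by (f_equal; ring). apply is_lim_seq_minus'. apply is_lim_seq_const.
      apply (is_lim_seq_incr_1 (fun n => / INR (S n))). apply (is_lim_seq_incr_1 (fun n => / INR n)).
      replace (Finite 0) with (Rbar_inv p_infty) by reflexivity.
      apply is_lim_seq_inv. apply is_lim_seq_INR. discriminate.
Qed.

Lemma is_lim_pole_zeta (q y : R) (s : nat) : Rabs q <= 1 -> 0 <= y -> (2 <= s)%nat ->
  is_lim_seq (sum_n (fun j => q ^ j / (pole j + y) ^ s)) (pole_zeta q y s).
Proof.
  intros Hq Hy Hs. apply (Series_correct (fun j => q ^ j / (pole j + y) ^ s)).
  apply (ex_series_le (V := R_CompleteNormedModule)) with (2 := ex_series_inv_sq_pole).
  intros j. change (norm ?u) with (Rabs u).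
  generalize (pole_gt_1 j); intros Hp.
  assert (H1 : 1 <= (pole j + y) ^ (s - 2)) by (apply pow_R1_Rle; lra).
  assert (H2 : pole j ^ 2 <= (pole j + y) ^ s).
  { replace s with (2 + (s - 2))%nat by lia. rewrite pow_add.
    apply Rle_trans with ((pole j + y) ^ 2 * 1). nra. apply Rmult_le_compat_l; nra. }
  unfold Rdiv. rewrite Rabs_mult, <- RPow_abs.
  rewrite (Rabs_right (/ _)) by (apply Rle_ge, Rlt_le, Rinv_0_lt_compat; nra).
  rewrite <- (Rmult_1_l (/ pole j ^ 2)). apply Rmult_le_compat.
  - apply pow_le, Rabs_pos.
  - apply Rlt_le, Rinv_0_lt_compat; nra.
  - rewrite <- (pow1 j). apply pow_incr. split; trivial. apply Rabs_pos.
  - apply Rinv_le_contravar; nra.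
Qed.

Lemma inv_sq_sum_pow_le (x y : R) (k : nat) : 0 < y ->
  / (x ^ 2 + y ^ 2) ^ S k <= (/ y ^ 2) ^ k * / (x ^ 2 + y ^ 2).
Proof.
  intros Hy. simpl ((x ^ 2 + y ^ 2) ^ S k). rewrite Rinv_mult, Rmult_comm.
  apply Rmult_le_compat_r. apply Rlt_le, Rinv_0_lt_compat; nra.
  rewrite pow_inv. apply Rinv_le_contravar. apply pow_lt; nra. apply pow_incr. nra.
Qed.

(** The truncation error is [C / (K + 1)] times the weight [/ (x ^ 2 + y ^ 2)], whose primitive
    [/ y * atan (x / y)] is bounded. The dependence of the bounds on [y] is harmless because [y] is
    fixed here. *)
Lemma is_RInt_pos_pole_series (f : R -> R) (part : nat -> R -> R) (q y s C : R) (N : nat) :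
  0 < y -> Rabs q <= 1 -> (2 <= N)%nat ->
  (forall x, 0 < x -> continuous f x) ->
  (forall K x, 0 < x ->
     Rabs (f x - part K x) * Rabs (ire y N x) <= C / INR (S K) * / (x ^ 2 + y ^ 2)) ->
  (forall K, is_RInt_pos (fun x => part K x * ire y N x)
     (s * sum_n (fun j => q ^ j / (pole j + y) ^ N) K)) ->
  is_RInt_pos (fun x => f x * ire y N x) (s * pole_zeta q y N).
Proof.
  intros Hy Hq HN Hf Hb HI.
  apply (is_RInt_pos_approx _ (fun x => / (x ^ 2 + y ^ 2)) (fun x => / y * atan (x / y)) (/ y * (PI / 2))).
  - intros x Hx. apply (continuous_mult f (ire y N)); auto. now apply ire_continuous.
  - intros x Hx. auto_derive; trivial. field. split; nra.
  - intros x Hx. apply (ex_derive_continuous (fun x => / (x ^ 2 + y ^ 2))). auto_derive. nra.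
  - intros x Hx. rewrite Rabs_mult, (Rabs_right (/ y)) by (apply Rle_ge, Rlt_le; now apply Rinv_0_lt_compat).
    apply Rmult_le_compat_l. apply Rlt_le; now apply Rinv_0_lt_compat.
    generalize (atan_bound (x / y)); intros. apply Rabs_le; lra.
  - intros eps He.
    assert (H1 : is_lim_seq (fun K => s * sum_n (fun j => q ^ j / (pole j + y) ^ N) K) (s * pole_zeta q y N)).
    { apply (is_lim_seq_scal_l _ s (pole_zeta q y N)). apply is_lim_pole_zeta; trivial. lra. }
    assert (H2 : is_lim_seq (fun K => C / INR (S K)) 0).
    { replace (Finite 0) with (Rbar_mult C (Rbar_inv p_infty)) by (simpl; f_equal; ring).
      apply is_lim_seq_scal_l. apply is_lim_seq_inv; [|discriminate].
      apply (is_lim_seq_incr_1 (fun n => INR n)). apply is_lim_seq_INR. }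
    apply is_lim_seq_spec in H1. apply is_lim_seq_spec in H2.
    destruct (H1 (mkposreal eps He)) as [K1 HK1]. destruct (H2 (mkposreal eps He)) as [K2 HK2].
    simpl in HK1, HK2. set (K := max K1 K2).
    specialize (HK1 K ltac:(lia)). specialize (HK2 K ltac:(lia)).
    exists (fun x => part K x * ire y N x), (s * sum_n (fun j => q ^ j / (pole j + y) ^ N) K).
    repeat split; [apply HI | lra |].
    intros x Hx. rewrite <- Rmult_minus_distr_r, Rabs_mult.
    apply Rle_trans with (1 := Hb K x Hx). apply Rmult_le_compat_r.
    apply Rlt_le, Rinv_0_lt_compat; nra. rewrite Rminus_0_r in HK2. apply Rabs_def2 in HK2. simpl in *. lra.
Qed.

Lemma is_RInt_pos_tanh_ire (y : R) (k : nat) : 0 < y < 1 ->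
  is_RInt_pos (fun x => tanh x * ire y (2 * k + 3) x)
    ((-1) ^ S k * PI * pole_zeta 1 y (2 * k + 3)).
Proof.
  intros Hy. replace (2 * k + 3)%nat with (2 * S k + 1)%nat by lia.
  (* The constant combines 2 from [tanh_partial_tail] with [(/ y ^ 2) ^ k], the price of reducing
     the power [S k] of [x ^ 2 + y ^ 2] to the first. *)
  apply (is_RInt_pos_pole_series tanh tanh_partial 1 y ((-1) ^ S k * PI) (2 * (/ y ^ 2) ^ k)); try lra; try lia.
  - rewrite Rabs_R1. lra.
  - intros x _. apply (ex_derive_continuous tanh). unfold tanh, sinh, cosh. auto_derive.
    generalize (exp_pos x) (exp_pos (- x)); lra.
  - intros K x Hx. generalize (tanh_partial_tail x K Hx) (ire_odd_bound y x (S k) ltac:(lra) Hx)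
      (inv_sq_sum_pow_le x y k ltac:(lra)) (Rabs_pos (ire y (2 * S k + 1) x)).
    assert (Hi : 0 < / INR (S K)) by (apply Rinv_0_lt_compat, lt_0_INR; lia).
    set (A := Rabs (tanh x - _)). set (B := Rabs (ire _ _ _)). intros H1 H2 H3 H4.
    apply Rle_trans with (2 * x / INR (S K) * B). { now apply Rmult_le_compat_r. }
    replace (2 * x / INR (S K) * B) with (2 * / INR (S K) * (x * B)) by (unfold Rdiv; ring).
    replace (2 * (/ y ^ 2) ^ k / INR (S K) * / (x ^ 2 + y ^ 2)) with
      (2 * / INR (S K) * ((/ y ^ 2) ^ k * / (x ^ 2 + y ^ 2))) by (unfold Rdiv; ring).
    apply Rmult_le_compat_l; lra.
  - intros K. rewrite <- (sum_n_mult_l (K := R_Ring)).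
    apply is_RInt_pos_ext with (fun x => sum_n (fun j => 2 * x / (x ^ 2 + pole j ^ 2) * ire y (2 * S k + 1) x) K).
    + intros x _. apply (sum_n_mult_r (K := R_Ring)).
    + apply is_RInt_pos_sum_n. intros j.
      change (mult ?u ?v) with (u * v).
      replace ((-1) ^ S k * PI * (1 ^ j / (pole j + y) ^ (2 * S k + 1))) with
       ((-1) ^ S k * PI / (pole j + y) ^ (2 * S k + 1)) by (rewrite pow1; unfold Rdiv; ring).
      apply is_RInt_pos_pole_odd. generalize (pole_gt_1 j); lra.
Qed.

Lemma is_RInt_pos_sech_ire (y : R) (k : nat) : 0 < y < 1 ->
  is_RInt_pos (fun x => / cosh x * ire y (2 * k + 2) x)
    ((-1) ^ S k * PI * pole_zeta (-1) y (2 * k + 2)).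
Proof.
  intros Hy.
  apply (is_RInt_pos_pole_series (fun x => / cosh x) sech_partial (-1) y ((-1) ^ S k * PI) (2 * PI * (/ y ^ 2) ^ k)); try lra; try lia.
  - rewrite Rabs_left; lra.
  - intros x _. apply (ex_derive_continuous (fun x => / cosh x)). unfold cosh. auto_derive.
    generalize (exp_pos x) (exp_pos (- x)); lra.
  - intros K x Hx. generalize (sech_partial_tail x K) (ire_even_bound y x (S k) ltac:(lra) Hx)
      (inv_sq_sum_pow_le x y k ltac:(lra)) (Rabs_pos (ire y (2 * S k) x)) PI_RGT_0.
    replace (2 * S k)%nat with (2 * k + 2)%nat by lia.
    assert (Hi : 0 < / INR (S K)) by (apply Rinv_0_lt_compat, lt_0_INR; lia).
    set (A := Rabs (/ cosh x - _)). set (B := Rabs (ire _ _ _)). intros H1 H2 H3 H4 HP.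
    apply Rle_trans with (2 * PI / INR (S K) * B). { now apply Rmult_le_compat_r. }
    replace (2 * PI * (/ y ^ 2) ^ k / INR (S K) * / (x ^ 2 + y ^ 2)) with
      (2 * PI / INR (S K) * ((/ y ^ 2) ^ k * / (x ^ 2 + y ^ 2))) by (unfold Rdiv; ring).
    apply Rmult_le_compat_l. unfold Rdiv; nra. lra.
  - intros K. rewrite <- (sum_n_mult_l (K := R_Ring)).
    apply is_RInt_pos_ext with (fun x => sum_n (fun j => (-1) ^ j * (2 * pole j) / (x ^ 2 + pole j ^ 2) * ire y (2 * k + 2) x) K).
    + intros x _. apply (sum_n_mult_r (K := R_Ring)).
    + apply is_RInt_pos_sum_n. intros j.
      change (mult ?u ?v) with (u * v).
      replace ((-1) ^ S k * PI * ((-1) ^ j / (pole j + y) ^ (2 * k + 2))) with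
       ((-1) ^ j * ((-1) ^ S k * PI / (pole j + y) ^ (2 * k + 2))) by (unfold Rdiv; ring).
      apply is_RInt_pos_ext with (fun x => (-1) ^ j * (2 * pole j / (x ^ 2 + pole j ^ 2) * ire y (2 * k + 2) x)).
      { intros x _. unfold Rdiv. ring. }
      apply is_RInt_pos_scal, is_RInt_pos_pole_even. generalize (pole_gt_1 j); lra.
Qed.

(** * Integration by parts and its coefficient recursion *)

Definition tanh_sech (d M : nat) (x : R) : R := tanh x ^ M * (/ cosh x) ^ d.

Lemma is_derive_tanh (x : R) : is_derive tanh x (1 - tanh x ^ 2).
Proof.
  unfold tanh, sinh, cosh. auto_derive; generalize (exp_pos x) (exp_pos (- x)); intros; [lra|].
  field. lra.
Qed.

Lemma is_derive_sech (x : R) : is_derive (fun x => / cosh x) x (- tanh x * / cosh x).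
Proof.
  unfold tanh, sinh, cosh. auto_derive; generalize (exp_pos x) (exp_pos (- x)); intros; [lra|].
  field. lra.
Qed.

Lemma is_derive_tanh_sech (d M : nat) (x : R) :
  is_derive (tanh_sech d M) x
    (INR M * tanh_sech d (M - 1) x - INR (M + d) * tanh_sech d (M + 1) x).
Proof.
  generalize (is_derive_pow _ M _ _ (is_derive_tanh x)) (is_derive_pow _ d _ _ (is_derive_sech x)).
  intros H1 H2.
  generalize (is_derive_mult (fun x => tanh x ^ M) (fun x => (/ cosh x) ^ d) x _ _ H1 H2 Rmult_comm).
  unfold tanh_sech.
  match goal with |- is_derive _ _ ?u -> is_derive _ _ ?v => assert (E : @eq R u v) end.
  2:{ rewrite E. trivial. }
  change (plus ?u ?v) with (u + v). change (mult ?u ?v) with (u * v).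
  rewrite plus_INR, pow_add, pow_1.
  assert (Ed : INR d * (- tanh x * / cosh x) * (/ cosh x) ^ pred d = - INR d * tanh x * (/ cosh x) ^ d).
  { destruct d as [|d]. simpl; ring. simpl pred. simpl pow. ring. }
  assert (EM : INR M * (1 - tanh x ^ 2) * tanh x ^ pred M = INR M * tanh x ^ (M - 1) - INR M * (tanh x ^ M * tanh x)).
  { destruct M as [|M]. simpl; ring. simpl pred. replace (S M - 1)%nat with M by lia. simpl pow. ring. }
  change (mult ?u ?v) with (u * v).
  rewrite EM, Ed. ring.
Qed.

Lemma tanh_abs_le_1 (x : R) : Rabs (tanh x) <= 1.
Proof.
  unfold tanh, sinh, cosh. generalize (exp_pos x) (exp_pos (- x)); intros.
  apply Rabs_le. split.
  - apply Rmult_le_reg_r with ((exp x + exp (- x)) / 2). lra.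
    unfold Rdiv at 2. rewrite Rmult_assoc, Rinv_l by lra. lra.
  - apply Rmult_le_reg_r with ((exp x + exp (- x)) / 2). lra.
    unfold Rdiv at 1. rewrite Rmult_assoc, Rinv_l by lra. lra.
Qed.

Lemma cosh_ge_1 (x : R) : 1 <= cosh x.
Proof.
  unfold cosh. rewrite exp_Ropp. generalize (exp_pos x). set (e := exp x). intros He.
  assert (0 <= (e - 1) ^ 2 * / e).
  { apply Rmult_le_pos. apply pow2_ge_0. now apply Rlt_le, Rinv_0_lt_compat. }
  replace ((e - 1) ^ 2 * / e) with (e - 2 + / e) in * by (field; lra). lra.
Qed.

Lemma sech_bound (x : R) : 0 < / cosh x <= 1.
Proof.
  generalize (cosh_ge_1 x); intros H. split. apply Rinv_0_lt_compat; lra.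
  rewrite <- Rinv_1. apply Rinv_le_contravar; lra.
Qed.

Lemma tanh_sech_abs_le_1 (d M : nat) (x : R) : Rabs (tanh_sech d M x) <= 1.
Proof.
  unfold tanh_sech. rewrite Rabs_mult, <- !RPow_abs.
  assert (H : forall u n, Rabs u <= 1 -> 0 <= Rabs u ^ n <= 1).
  { intros u n Hu. split. apply pow_le, Rabs_pos. rewrite <- (pow1 n). apply pow_incr. split; trivial. apply Rabs_pos. }
  generalize (H _ M (tanh_abs_le_1 x)) (H (/ cosh x) d). intros H1 H2.
  rewrite (Rabs_right (/ cosh x)) in * by (generalize (sech_bound x); lra).
  specialize (H2 ltac:(generalize (sech_bound x); lra)). nra.
Qed.

Lemma tanh_sech_continuous (d M : nat) (x : R) : continuous (tanh_sech d M) x.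
Proof. apply (ex_derive_continuous (tanh_sech d M)). eexists. apply is_derive_tanh_sech. Qed.

(** The product of [tanh_sech d M] and [ire y N] has zero boundary values: at infinity by decay, at
    0 because either [tanh 0 = 0] occurs to a positive power or [N] is odd and [(i y)^-N] is
    imaginary. For [M = 0] the truncated [M - 1] is harmless, since its coefficient [INR M] is 0. *)
Lemma is_RInt_pos_by_parts (d M N : nat) (y a b : R) :
  0 < y -> (0 < M + d)%nat -> (0 < N)%nat -> (0 < M \/ Nat.Odd N)%nat ->
  (M = 0%nat \/ is_RInt_pos (fun x => tanh_sech d (M - 1) x * ire y N x) a) ->
  is_RInt_pos (fun x => tanh_sech d M x * ire y (S N) x) b ->
  is_RInt_pos (fun x => tanh_sech d (M + 1) x * ire y N x)
    (/ INR (M + d) * (INR M * a - INR N * b)).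
Proof.
  intros Hy HMd HN H0 Ha Hb.
  assert (Hp : 0 < INR (M + d)) by now apply lt_0_INR.
  assert (Ha' : is_RInt_pos (fun x => INR M * (tanh_sech d (M - 1) x * ire y N x)) (INR M * a)).
  (* For [M = 0] the integral of the zero function is obtained by scaling the available integral
     [Hb] by 0. *)
  { destruct Ha as [->|Ha].
    - generalize (is_RInt_pos_scal _ 0 _ Hb). simpl INR. rewrite !Rmult_0_l.
      apply is_RInt_pos_ext. intros; ring.
    - now apply is_RInt_pos_scal. }
  set (D := fun x => (INR M * tanh_sech d (M - 1) x - INR (M + d) * tanh_sech d (M + 1) x) * ire y N x
      + tanh_sech d M x * (- INR N * ire y (S N) x)).
  assert (HD : is_RInt_pos D (0 - 0)).
  { apply (is_RInt_pos_derive (fun x => tanh_sech d M x * ire y N x)).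
    - intros x _. apply (is_derive_mult (tanh_sech d M) (ire y N) x).
      apply is_derive_tanh_sech. exact (proj1 (is_derive_ipow y N x Hy)). exact Rmult_comm.
    - intros x _. unfold D.
      apply (continuous_plus (fun x => (INR M * tanh_sech d (M - 1) x - INR (M + d) * tanh_sech d (M + 1) x) * ire y N x)
         (fun x => tanh_sech d M x * (- INR N * ire y (S N) x))).
      + apply (continuous_mult (fun x => INR M * tanh_sech d (M - 1) x - INR (M + d) * tanh_sech d (M + 1) x) (ire y N)).
        * apply (continuous_minus (fun x => INR M * tanh_sech d (M - 1) x) (fun x => INR (M + d) * tanh_sech d (M + 1) x)).
          apply (continuous_scal_r (INR M) (tanh_sech d (M - 1))), tanh_sech_continuous.
          apply (continuous_scal_r (INR (M + d)) (tanh_sech d (M + 1))), tanh_sech_continuous.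
        * now apply ire_continuous.
      + apply (continuous_mult (tanh_sech d M) (fun x => - INR N * ire y (S N) x)). apply tanh_sech_continuous.
        apply (continuous_scal_r (- INR N) (ire y (S N))). now apply ire_continuous.
    - apply (filterlim_at_right_0 (fun x => tanh_sech d M x * ire y N x)).
      + apply (continuous_mult (tanh_sech d M) (ire y N)). apply tanh_sech_continuous. now apply ire_continuous.
      + destruct H0 as [HM|[k HNk]].
        * unfold tanh_sech, tanh. rewrite sinh_0. destruct M; [lia|]. simpl. unfold Rdiv. ring.
        * rewrite HNk, (proj2 (ipow_0 y k Hy)). ring.
    - apply filterlim_p_infty_0 with 1. intros x Hx. rewrite Rabs_mult.
      rewrite <- (Rmult_1_l (1 / x)). apply Rmult_le_compat; try apply Rabs_pos.
      apply tanh_sech_abs_le_1. apply Rle_trans with (1 := ire_le_Cmod _ _ _).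
      destruct N; [lia|]. now apply Cmod_Cinv_pow_le. }
  generalize (is_RInt_pos_scal _ (/ INR (M + d)) _
    (is_RInt_pos_minus _ _ _ _ (is_RInt_pos_minus _ _ _ _ Ha' (is_RInt_pos_scal _ (INR N) _ Hb)) HD)).
  rewrite !Rminus_0_r. apply is_RInt_pos_ext. intros x Hx. unfold D. field. lra.
Qed.

(* [cot_coef d M k] is the coefficient of [u^(M+d-1-k)] in
   [(u / sin u)^d (u cot u)^M]; see [coef_csc_cot]. *)
Fixpoint cot_coef (d M k : nat) : R :=
  match M with
  | O => if Nat.eqb k 0 then INR d else 0
  | S M1 =>
      match M1 with
      | O => if Nat.eqb k d then 1 else 0
      | S M2 => (INR k * cot_coef d M1 (k - 1) - INR M1 * cot_coef d M2 k) / INR (M1 + d)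
      end
  end.

(** The truncated [k - 1] and [M - 1] do no harm at 0, as they come with the factors [INR k] and
    [INR M]. *)
Lemma cot_coef_rec (d M k : nat) : (d <= 1)%nat -> (0 < M + d)%nat ->
  INR (M + d) * cot_coef d (M + 1) k =
  INR k * cot_coef d M (k - 1) - INR M * cot_coef d (M - 1) k.
Proof.
  intros Hd H. rewrite Nat.add_1_r. destruct M as [|M].
  - assert (d = 1%nat) as -> by lia.
    destruct k as [|[|k]]; simpl; ring.
  - assert (Hp : INR (S M + d) <> 0) by (apply not_0_INR; lia).
    replace (S M - 1)%nat with M by lia.
    change (cot_coef d (S (S M)) k) with
      ((INR k * cot_coef d (S M) (k - 1) - INR (S M) * cot_coef d M k) / INR (S M + d)).
    field. trivial.
Qed.

Lemma cot_coef_eq_0 (d M k : nat) : (d <= 1)%nat -> (M + d <= k)%nat -> cot_coef d M k = 0.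
Proof.
  intros Hd. revert k.
  assert (H : forall k, ((M + d <= k)%nat -> cot_coef d M k = 0) /\
             ((M + 1 + d <= k)%nat -> cot_coef d (M + 1) k = 0)).
  2:{ intros k. apply H. }
  induction M as [|M IH]; intros k.
  - split; intros Hk.
    + destruct d as [|d]; simpl; destruct (Nat.eqb_spec k 0); trivial; lia.
    + simpl. destruct (Nat.eqb_spec k d); trivial; lia.
  - split; intros Hk.
    + rewrite <- Nat.add_1_r in *. now apply IH.
    + apply Rmult_eq_reg_l with (INR (S M + d)); [|apply not_0_INR; lia].
      rewrite cot_coef_rec by lia. replace (S M - 1)%nat with M by lia.
      rewrite <- (Nat.add_1_r M) at 1.
      rewrite (proj2 (IH (k - 1)%nat)), (proj1 (IH k)) by lia. ring.
Qed.

(** * Closed form of the regularised moments *)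

Ltac eq_over_R := match goal with |- @eq _ ?l ?r => change (@eq R l r) end.

Lemma sum_n_shift (f : nat -> R) (K : nat) :
  sum_n f (S K) = f 0%nat + sum_n (fun k => f (S k)) K.
Proof.
  induction K as [|K IH].
  - rewrite sum_n_SR, !sum_O. trivial.
  - rewrite sum_n_SR, IH, (sum_n_SR (fun k => f (S k))). eq_over_R. ring.
Qed.

(** Up to signs this is a sum of residues: [cot_coef d M k] gives the principal part of
    [tanh_sech d M] at a pole, and the binomial comes from expanding the [-N]-th power there. Any
    [K >= M + d] gives the same value, so one [K] can serve the whole recursion. *)
Definition moment_sum (Z : nat -> R) (d M N K : nat) : R :=
  sum_n (fun k => (-1) ^ k * cot_coef d M k * Binomial.C (N + k - 1) (N - 1) * Z (N + k)%nat) K.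

(** Converts the factor [k] of [cot_coef_rec] into the factor [N] produced by differentiating the
    [-N]-th power. *)
Lemma C_absorption (N k : nat) : (0 < N)%nat ->
  INR (S k) * Binomial.C (N + S k - 1) (N - 1) = INR N * Binomial.C (S N + k - 1) (S N - 1).
Proof.
  intros HN. destruct N as [|N]; [lia|]. unfold Binomial.C.
  replace (S N + S k - 1)%nat with (N + S k)%nat by lia.
  replace (S (S N) + k - 1)%nat with (N + S k)%nat by lia.
  replace (S N - 1)%nat with N by lia. replace (S (S N) - 1)%nat with (S N) by lia.
  replace (N + S k - N)%nat with (S k) by lia. replace (N + S k - S N)%nat with k by lia.
  change (Factorial.fact (S k)) with (S k * Factorial.fact k)%nat.
  change (Factorial.fact (S N)) with (S N * Factorial.fact N)%nat.
  rewrite !mult_INR.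
  assert (INR (S k) <> 0) by (apply not_0_INR; lia).
  assert (INR (S N) <> 0) by (apply not_0_INR; lia).
  field. repeat split; trivial; apply INR_fact_neq_0.
Qed.

(** After [cot_coef_rec] the index is shifted by one: the term at 0 carries [INR 0], and the extra
    top term vanishes by [cot_coef_eq_0]. The sign of the [M - 1] term differs from
    [is_RInt_pos_by_parts]; the prefactor [(-1) ^ h] accounts for it. *)
Lemma moment_sum_rec (Z : nat -> R) (d M N K : nat) :
  (d <= 1)%nat -> (0 < M + d)%nat -> (0 < N)%nat -> (M + d <= K)%nat ->
  INR (M + d) * moment_sum Z d (M + 1) N K =
  - INR M * moment_sum Z d (M - 1) N K - INR N * moment_sum Z d M (S N) K.
Proof.
  intros Hd HMd HN HK.
  assert (E : INR (M + d) * moment_sum Z d (M + 1) N K + INR M * moment_sum Z d (M - 1) N K =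
    sum_n (fun k => (-1) ^ k * (INR k * cot_coef d M (k - 1)) * Binomial.C (N + k - 1) (N - 1) * Z (N + k)%nat) K).
  { unfold moment_sum. clear HK. induction K as [|K IH].
    - rewrite !sum_O. rewrite <- (Rplus_0_r (INR 0 * _)), <- (Rplus_opp_r (INR M * cot_coef d (M - 1) 0)).
      generalize (cot_coef_rec d M 0 Hd HMd). intros H.
      replace (INR 0 * cot_coef d M (0 - 1) + (INR M * cot_coef d (M - 1) 0 + - (INR M * cot_coef d (M - 1) 0)))
        with (INR (M + d) * cot_coef d (M + 1) 0 + INR M * cot_coef d (M - 1) 0) by lra. ring.
    - rewrite !sum_n_SR, <- IH. generalize (cot_coef_rec d M (S K) Hd HMd). intros H.
      replace (INR (S K) * cot_coef d M (S K - 1))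
        with (INR (M + d) * cot_coef d (M + 1) (S K) + INR M * cot_coef d (M - 1) (S K)) by lra. ring. }
  assert (E2 : sum_n (fun k => (-1) ^ k * (INR k * cot_coef d M (k - 1)) * Binomial.C (N + k - 1) (N - 1) * Z (N + k)%nat) K
    = - INR N * moment_sum Z d M (S N) K).
  { destruct K as [|K]; [lia|]. rewrite sum_n_shift.
    unfold moment_sum. rewrite sum_n_SR, (cot_coef_eq_0 d M (S K)) by lia. simpl INR at 1.
    rewrite Rmult_plus_distr_l, <- (sum_n_mult_l (K := R_Ring)).
    match goal with |- _ + ?u = ?v + _ => assert (Euv : u = v) end.
    - apply sum_n_ext. intros k. change (mult ?a ?b) with (a * b).
      generalize (C_absorption N k HN). replace (S k - 1)%nat with k by lia.
      replace (S N + k)%nat with (N + S k)%nat by lia. intros H.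
      eq_over_R.
      replace ((-1) ^ S k) with (- (-1) ^ k) by (simpl; ring).
      transitivity (- (-1) ^ k * cot_coef d M k * (INR (S k) * Binomial.C (N + S k - 1) (N - 1)) * Z (N + S k)%nat).
      + ring.
      + rewrite H. ring.
    - rewrite Euv. eq_over_R. ring. }
  lra.
Qed.

(** The ratio of principal parts at consecutive poles: translation by [i pi] fixes [tanh] and
    negates [cosh]. *)
Definition pole_sign (d : nat) : R := if Nat.eqb d 0 then 1 else -1.

(* [2 <= N + d] excludes [d = 0], [N = 1], where [tanh x * Re (x + i y)^-1] is not integrable. *)
Lemma is_RInt_pos_tanh_sech_ire (d M N h K : nat) (y : R) :
  (d <= 1)%nat -> 0 < y < 1 -> (2 <= N + d)%nat -> (0 < N)%nat ->
  (M + N = 2 * h)%nat -> (M + d <= K)%nat ->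
  is_RInt_pos (fun x => tanh_sech d M x * ire y N x)
    (- PI * (-1) ^ d * (-1) ^ h * moment_sum (pole_zeta (pole_sign d) y) d M N K).
Proof.
  intros Hd Hy. revert N h.
  (* The statement is kept for all [N] and [h], because the step from [M] to [M + 1] needs [M] at
     [N + 1] and [M - 1] at [N]. *)
  set (P := fun M => forall N h, (2 <= N + d)%nat -> (0 < N)%nat -> (M + N = 2 * h)%nat -> (M + d <= K)%nat ->
     is_RInt_pos (fun x => tanh_sech d M x * ire y N x)
    (- PI * (-1) ^ d * (-1) ^ h * moment_sum (pole_zeta (pole_sign d) y) d M N K)).
  change (P M).
  assert (Hone : forall (f : nat -> R) i n, (i <= n)%nat -> (forall k, k <> i -> f k = 0) -> sum_n f n = f i).
  { intros f i n Hi Hf. induction n as [|n IHn].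
    - rewrite sum_O. f_equal. lia.
    - rewrite sum_n_SR. destruct (Nat.eq_dec i (S n)) as [->|Hne].
      + rewrite (sum_n_ext_loc f (fun _ => 0)).
        * rewrite (sum_n_const n 0), Rmult_0_r. apply Rplus_0_l.
        * intros k Hk. apply Hf. lia.
      + rewrite IHn, (Hf (S n)) by lia. apply Rplus_0_r. }
  assert (Hstep : forall M, (0 < M + d)%nat -> (M = 0%nat \/ P (M - 1)%nat) -> P M -> P (M + 1)%nat).
  { intros m Hm H1 H2 N h HN HN0 Hh HK.
    assert (Hp : INR (m + d) <> 0) by (apply not_0_INR; lia).
    destruct h as [|h]; [lia|].
    generalize (is_RInt_pos_by_parts d m N y
      (- PI * (-1) ^ d * (-1) ^ h * moment_sum (pole_zeta (pole_sign d) y) d (m - 1) N K)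
      (- PI * (-1) ^ d * (-1) ^ S h * moment_sum (pole_zeta (pole_sign d) y) d m (S N) K)
      ltac:(lra) Hm HN0).
    intros H. 
    match goal with |- is_RInt_pos _ ?v =>
      replace v with (/ INR (m + d) * (INR m * (- PI * (-1) ^ d * (-1) ^ h * moment_sum (pole_zeta (pole_sign d) y) d (m - 1) N K)
       - INR N * (- PI * (-1) ^ d * (-1) ^ S h * moment_sum (pole_zeta (pole_sign d) y) d m (S N) K))) end.
    - apply H.
      (* For [m = 0] the parity condition reads [N = 2 * h + 1], the odd case that makes the
         boundary term vanish. *)
      + destruct m; [right; exists h; lia | left; lia].
      + destruct (Nat.eq_dec m 0) as [Hm0|Hm0]; [now left | right].
        destruct H1 as [H1|H1]; [lia | apply H1; lia].
      + apply H2; lia.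
    - apply Rmult_eq_reg_l with (INR (m + d)); trivial.
      rewrite <- Rmult_assoc, Rinv_r, Rmult_1_l by trivial.
      replace (INR (m + d) * (- PI * (-1) ^ d * (-1) ^ S h * moment_sum (pole_zeta (pole_sign d) y) d (m + 1) N K))
        with (- PI * (-1) ^ d * (-1) ^ S h * (INR (m + d) * moment_sum (pole_zeta (pole_sign d) y) d (m + 1) N K)) by ring.
      rewrite moment_sum_rec by lia. simpl ((-1) ^ S h). ring. }
  (* For [d = 0] the recursion cannot start from [M = 0], since [M + d] would be 0: the cases are
     the vanishing integral of [ire] and the moments of [tanh]. For [d = 1] the moments of
     [1 / cosh] suffice, and [M = 1] follows by one step. *)
  assert (H01 : P 0%nat /\ P 1%nat).
  { destruct d as [|d].
    - split; intros N h HN HN0 Hh HK.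
      + destruct h as [|h]; [lia|]. replace N with (2 * h + 2)%nat by lia.
        unfold moment_sum. rewrite (Hone _ 0%nat) by (lia || (intros; simpl; destruct (Nat.eqb k 0); ring)).
        simpl cot_coef.
        match goal with |- is_RInt_pos _ ?v => replace v with 0 by ring end.
        apply is_RInt_pos_ext with (ire y (2 * h + 2)). { intros x _. unfold tanh_sech. simpl. ring. }
        apply is_RInt_pos_ire. lra.
      + destruct h as [|[|h]]; try lia. replace N with (2 * h + 3)%nat by lia.
        unfold moment_sum. rewrite (Hone _ 0%nat) by (lia || (intros k Hk; simpl; destruct (Nat.eqb_spec k 0); [lia|ring])).
        change (cot_coef 0 1 0) with 1. change (pole_sign 0) with 1.
        replace (2 * h + 3 + 0)%nat with (2 * h + 3)%nat by lia. rewrite pascal_step1 by lia.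
        rewrite Nat.sub_diag. unfold Binomial.C at 1. rewrite Nat.sub_0_r. change (Factorial.fact 0) with 1%nat.
        match goal with |- is_RInt_pos _ ?v => replace v with ((-1) ^ S h * PI * pole_zeta 1 y (2 * h + 3)) end.
        2:{ simpl ((-1) ^ S _). simpl ((-1) ^ 0). simpl INR. field. apply INR_fact_neq_0. }
        apply is_RInt_pos_ext with (fun x => tanh x * ire y (2 * h + 3) x).
        { intros x _. unfold tanh_sech. simpl. ring. }
        now apply is_RInt_pos_tanh_ire.
    - assert (d = 0%nat) as -> by lia.
      assert (H0 : P 0%nat).
      { intros N h HN HN0 Hh HK.
        destruct h as [|h]; try lia. replace N with (2 * h + 2)%nat by lia.
        unfold moment_sum. rewrite (Hone _ 0%nat) by (lia || (intros k Hk; simpl; destruct (Nat.eqb_spec k 0); [lia|ring])).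
        change (cot_coef 1 0 0) with 1. change (pole_sign 1) with (-1).
        replace (2 * h + 2 + 0)%nat with (2 * h + 2)%nat by lia. rewrite pascal_step1 by lia.
        rewrite Nat.sub_diag. unfold Binomial.C at 1. rewrite Nat.sub_0_r. change (Factorial.fact 0) with 1%nat.
        match goal with |- is_RInt_pos _ ?v => replace v with ((-1) ^ S h * PI * pole_zeta (-1) y (2 * h + 2)) end.
        2:{ simpl ((-1) ^ S _). simpl ((-1) ^ 0). simpl ((-1) ^ 1). simpl INR. field. apply INR_fact_neq_0. }
        apply is_RInt_pos_ext with (fun x => / cosh x * ire y (2 * h + 2) x).
        { intros x _. unfold tanh_sech. simpl. ring. }
        now apply is_RInt_pos_sech_ire. }
      split; trivial. apply (Hstep 0%nat); auto. }
  assert (HP : P M /\ P (S M)).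
  { induction M as [|m [IH1 IH2]]; trivial. split; trivial.
    rewrite <- (Nat.add_1_r (S m)). apply Hstep; trivial. lia.
    right. now replace (S m - 1)%nat with m by lia. }
  intros N h. apply HP.
Qed.

(** * Removing the regularisation *)

Lemma tanh_between (x : R) : 0 < x -> 0 <= tanh x <= x.
Proof.
  intros Hx.
  destruct (MVT_gen tanh 0 x (fun c => 1 - tanh c ^ 2)) as [c [_ Hc]].
  - intros c _. apply is_derive_tanh.
  - intros c _. apply continuity_pt_filterlim, (ex_derive_continuous tanh). eexists. apply is_derive_tanh.
  - replace (tanh 0) with 0 in Hc by (unfold tanh; rewrite sinh_0; unfold Rdiv; ring).
    rewrite !Rminus_0_r in Hc. rewrite Hc.
    assert (0 <= tanh c ^ 2 <= 1).
    { split. apply pow2_ge_0. rewrite <- pow2_abs.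
      rewrite <- (pow1 2). apply pow_incr. split. apply Rabs_pos. apply tanh_abs_le_1. }
    nra.
Qed.

Lemma Cmod_1_sub_pow_le (e : C) (N : nat) : Cmod e <= 1 ->
  Cmod (1 - Cpow e N) <= INR N * Cmod (1 - e).
Proof.
  intros He. induction N as [|N IH].
  - simpl. replace (1 - 1)%C with (RtoC 0) by ring. rewrite Cmod_0. lra.
  - rewrite S_INR, Cpow_S.
    replace (1 - e * e ^ N)%C with ((1 - e) + e * (1 - e ^ N))%C by ring.
    apply Rle_trans with (1 := Cmod_triangle _ _). rewrite Cmod_mult.
    generalize (Cmod_ge_0 (1 - e ^ N)) (Cmod_ge_0 e). nra.
Qed.

(** With [e = x / (x + i y)] the relative error is at most [N * (y / x)] and also at most 2. The
    first bound alone is too singular at 0 and the second is not small; the square root lies above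
    their minimum, is integrable at 0 and tends to 0 with [y]. *)
Lemma inv_pow_sub_ire_le (x y : R) (N : nat) : 0 < x -> 0 < y -> (0 < N)%nat ->
  Rabs (/ x ^ N - ire y N x) <= / x ^ N * (2 * INR N * sqrt (y / x)).
Proof.
  intros Hx Hy HN.
  set (e := (RtoC x * Cinv (x, y))%C).
  assert (Hz : (x, y) <> RtoC 0) by (intros E; injection E; lra).
  assert (He : Cmod e <= 1).
  { unfold e. rewrite Cmod_mult, Cmod_R, Rabs_right by lra. now apply Cmod_Cinv_le. }
  assert (H1e : Cmod (1 - e) <= y / x).
  { replace (1 - e)%C with (RtoC (y / x) * (Ci * e))%C.
    - rewrite !Cmod_mult, Cmod_R, Cmod_Ci, Rabs_right.
      + rewrite Rmult_1_l. rewrite <- (Rmult_1_r (y / x)) at 2.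
        apply Rmult_le_compat_l; trivial. apply Rlt_le, Rdiv_lt_0_compat; lra.
      + apply Rle_ge, Rlt_le, Rdiv_lt_0_compat; lra.
    - unfold e. apply injective_projections; simpl; field; split; nra. }
  assert (Hp : 0 < x ^ N) by now apply pow_lt.
  assert (HR : / x ^ N - ire y N x = / x ^ N * Re (1 - Cpow e N)).
  { unfold e. rewrite Cpow_mult_l, <- RtoC_pow. unfold ire, ipow.
    destruct (Cpow (Cinv (x, y)) N) as [p q]. simpl. field. lra. }
  rewrite HR, Rabs_mult, Rabs_right by (generalize (Rinv_0_lt_compat _ Hp); lra).
  apply Rmult_le_compat_l. { generalize (Rinv_0_lt_compat _ Hp); lra. }
  apply Rle_trans with (1 := re_le_Cmod _).
  assert (HN1 : 1 <= INR N) by (apply (le_INR 1); lia).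
  assert (Hyx : 0 < y / x) by (apply Rdiv_lt_0_compat; lra).
  generalize (sqrt_pos (y / x)) (sqrt_sqrt (y / x) ltac:(lra)). set (t := sqrt (y / x)). intros Ht0 Htt.
  destruct (Rle_dec t 1) as [Ht|Ht].
  - apply Rle_trans with (1 := Cmod_1_sub_pow_le e N He).
    apply Rle_trans with (INR N * (t * t)). apply Rmult_le_compat_l; lra.
    replace (2 * INR N * t) with (INR N * (2 * t)) by ring. apply Rmult_le_compat_l; nra.
  - apply Rle_trans with 2.
    + unfold Cminus. apply Rle_trans with (1 := Cmod_triangle _ _).
      rewrite Cmod_opp, Cmod_pow, Cmod_1.
      assert (Cmod e ^ N <= 1). { rewrite <- (pow1 N). apply pow_incr. split; trivial. apply Cmod_ge_0. }
      lra.
    + nra.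
Qed.

(** As [N <= M], the quotient is at most [(tanh x / x)^N], hence at most both 1 and [/ x]. *)
Lemma tanh_sech_div_pow_le (d M N : nat) (x : R) : 0 < x -> (0 < N)%nat -> (N <= M)%nat ->
  Rabs (tanh_sech d M x) * / x ^ N <= 2 / (1 + x).
Proof.
  intros Hx HN HM. generalize (tanh_between x Hx) (tanh_abs_le_1 x) (sech_bound x).
  intros Ht Ht1 Hs. rewrite Rabs_right in Ht1 by lra.
  assert (Hp : forall u n, 0 <= u <= 1 -> 0 <= u ^ n <= 1).
  { intros u n Hu. split. apply pow_le; lra. rewrite <- (pow1 n). apply pow_incr; lra. }
  assert (Hf : Rabs (tanh_sech d M x) <= tanh x ^ N).
  { unfold tanh_sech. rewrite Rabs_right.
    - replace M with (N + (M - N))%nat by lia. rewrite pow_add.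
      generalize (Hp (tanh x) N ltac:(lra)) (Hp (tanh x) (M - N)%nat ltac:(lra)) (Hp (/ cosh x) d ltac:(lra)).
      generalize (tanh x ^ N) (tanh x ^ (M - N)) ((/ cosh x) ^ d). intros p q r Hp1 Hq Hr.
      rewrite Rmult_assoc. rewrite <- (Rmult_1_r p) at 2. apply Rmult_le_compat_l; nra.
    - apply Rle_ge, Rmult_le_pos; apply pow_le; lra. }
  assert (Hx0 : 0 < / x ^ N) by (apply Rinv_0_lt_compat; now apply pow_lt).
  apply Rle_trans with (tanh x ^ N * / x ^ N). { apply Rmult_le_compat_r; lra. }
  rewrite <- pow_inv, <- Rpow_mult_distr. fold (Rdiv (tanh x) x).
  assert (Hxi : 0 < / x) by now apply Rinv_0_lt_compat.
  assert (Hq : 0 <= tanh x / x <= 1).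
  { unfold Rdiv. split. nra. rewrite <- (Rinv_r x) by lra. apply Rmult_le_compat_r; lra. }
  assert (Hqx : tanh x / x <= / x). { unfold Rdiv. nra. }
  apply Rle_trans with (tanh x / x).
  { destruct N; [lia|]. simpl. generalize (Hp _ N Hq). nra. }
  apply Rmult_le_reg_r with (1 + x). lra.
  unfold Rdiv at 2. rewrite Rmult_assoc, Rinv_l, Rmult_1_r by lra.
  apply (Rmult_le_compat_r x) in Hqx; [|lra]. rewrite Rinv_l in Hqx by lra. lra.
Qed.

(** Termwise the difference is at most [s * y / pole j ^ 2], because both reciprocals are below 1;
    summing gives a Lipschitz bound in [y]. *)
Lemma pole_zeta_lim (q : R) (s : nat) (yn : nat -> R) : Rabs q <= 1 -> (2 <= s)%nat ->
  (forall n, 0 < yn n < 1) -> is_lim_seq yn 0 ->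
  is_lim_seq (fun n => pole_zeta q (yn n) s) (pole_zeta q 0 s).
Proof.
  intros Hq Hs Hyn Hlim.
  set (Z := Series (fun j => / pole j ^ 2)).
  assert (HD : forall y, 0 < y < 1 -> Rabs (pole_zeta q y s - pole_zeta q 0 s) <= INR s * Z * y).
  { intros y Hy.
    assert (H : forall u v n, 0 <= u <= v -> v <= 1 -> 0 <= v ^ n - u ^ n <= INR n * (v - u)).
    { intros u v n Huv Hv. induction n as [|n IH]. simpl; lra.
      rewrite S_INR. simpl pow.
      assert (0 <= v ^ n <= 1). { split. apply pow_le; lra. rewrite <- (pow1 n). apply pow_incr; lra. }
      replace (v * v ^ n - u * u ^ n) with ((v - u) * v ^ n + u * (v ^ n - u ^ n)) by ring. nra. }
    assert (HT : forall j, Rabs (q ^ j / (pole j + y) ^ s - q ^ j / (pole j + 0) ^ s) <= INR s * y * / pole j ^ 2).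
    { intros j. generalize (pole_gt_1 j). rewrite Rplus_0_r. set (a := pole j). intros Ha.
      unfold Rdiv. rewrite <- Rmult_minus_distr_l, Rabs_mult, <- RPow_abs, <- !pow_inv.
      assert (Hqj : 0 <= Rabs q ^ j <= 1).
      { split. apply pow_le, Rabs_pos. rewrite <- (pow1 j). apply pow_incr. split; trivial. apply Rabs_pos. }
      assert (H0 : 0 < / (a + y)) by (apply Rinv_0_lt_compat; lra).
      assert (H1 : / (a + y) <= / a) by (apply Rinv_le_contravar; lra).
      assert (H2 : / a <= 1) by (rewrite <- Rinv_1; apply Rinv_le_contravar; lra).
      assert (H3 : / a - / (a + y) <= y * / a ^ 2).
      { replace (/ a - / (a + y)) with (y * (/ a * / (a + y))) by (field; lra).
        replace (/ a ^ 2) with (/ a * / a) by (field; lra).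
        apply Rmult_le_compat_l. lra. apply Rmult_le_compat_l; lra. }
      generalize (H (/ (a + y)) (/ a) s ltac:(lra) H2). intros H4.
      rewrite Rabs_minus_sym, (Rabs_right (_ - _)) by lra.
      apply Rle_trans with (1 * ((/ a) ^ s - (/ (a + y)) ^ s)). { apply Rmult_le_compat_r; lra. }
      rewrite Rmult_1_l.
      generalize (pos_INR s). intros Hs0. apply Rle_trans with (1 := proj2 H4). rewrite Rmult_assoc.
      apply Rmult_le_compat_l; trivial. now rewrite pow_inv. }
    assert (HZ : is_lim_seq (fun n => INR s * y * sum_n (fun j => / pole j ^ 2) n) (INR s * y * Z)).
    { apply (is_lim_seq_scal_l _ (INR s * y) Z). apply (Series_correct _ ex_series_inv_sq_pole). }
    assert (HS : is_lim_seq (fun n => Rabs (sum_n (fun j => q ^ j / (pole j + y) ^ s) n -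
        sum_n (fun j => q ^ j / (pole j + 0) ^ s) n)) (Rabs (pole_zeta q y s - pole_zeta q 0 s))).
    { apply (is_lim_seq_abs _ (pole_zeta q y s - pole_zeta q 0 s)).
      apply is_lim_seq_minus'; apply is_lim_pole_zeta; trivial; lra. }
    replace (INR s * Z * y) with (INR s * y * Z) by ring.
    refine (is_lim_seq_le _ _ _ (INR s * y * Z) _ HS HZ). clear HS HZ.
    induction n as [|n IH].
    - rewrite !sum_O. apply HT.
    - rewrite !sum_n_SR. rewrite Rmult_plus_distr_l.
      match goal with |- Rabs (?a + ?b - (?c + ?e)) <= _ =>
        replace (a + b - (c + e)) with ((a - c) + (b - e)) by ring end.
      apply Rle_trans with (1 := Rabs_triang _ _). apply Rplus_le_compat; trivial. }
  apply is_lim_seq_ext with (fun n => pole_zeta q 0 s + (pole_zeta q (yn n) s - pole_zeta q 0 s)).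
  { intros n. ring. }
  replace (Finite (pole_zeta q 0 s)) with (Finite (pole_zeta q 0 s + 0)) by (f_equal; ring).
  apply is_lim_seq_plus'. apply is_lim_seq_const.
  apply is_lim_seq_abs_0. apply is_lim_seq_le_le with (fun _ => 0) (fun n => INR s * Z * yn n).
  - intros n. split. apply Rabs_pos. apply HD, Hyn.
  - apply is_lim_seq_const.
  - replace (Finite 0) with (Rbar_mult (INR s * Z) 0) by (simpl; f_equal; ring).
    now apply is_lim_seq_scal_l.
Qed.

(** Convergence is demanded only where the coefficient is nonzero: for [N = 1] the index [k = 0]
    would involve the exponent 1, outside the reach of [pole_zeta_lim]. *)
Lemma moment_sum_lim (Z : nat -> nat -> R) (Z0 : nat -> R) (d M N K : nat) :
  (forall k, cot_coef d M k <> 0 -> is_lim_seq (fun n => Z n (N + k)%nat) (Z0 (N + k)%nat)) ->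
  is_lim_seq (fun n => moment_sum (Z n) d M N K) (moment_sum Z0 d M N K).
Proof.
  intros H.
  assert (HT : forall k, is_lim_seq
     (fun n => (-1) ^ k * cot_coef d M k * Binomial.C (N + k - 1) (N - 1) * Z n (N + k)%nat)
     ((-1) ^ k * cot_coef d M k * Binomial.C (N + k - 1) (N - 1) * Z0 (N + k)%nat)).
  { intros k. destruct (Req_dec (cot_coef d M k) 0) as [E|E].
    - rewrite E. apply is_lim_seq_ext with (fun _ => 0). intros; ring.
      replace (Finite (_ * _)) with (Finite 0) by (f_equal; ring). apply is_lim_seq_const.
    - apply (is_lim_seq_scal_l _ _ (Z0 (N + k)%nat)). now apply H. }
  unfold moment_sum. induction K as [|K IH].
  - rewrite sum_O. apply is_lim_seq_ext with (2 := HT 0%nat). intros n. now rewrite sum_O.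
  - rewrite sum_n_SR.
    apply is_lim_seq_ext with (2 := is_lim_seq_plus' _ _ _ _ IH (HT (S K))).
    intros n. now rewrite sum_n_SR.
Qed.

(** Reflects that [(u / sin u)^d (u cot u)^M] is even, so that its coefficients at odd
    [M + d - 1 - k] vanish; the proof uses the recursion alone. *)
Lemma cot_coef_parity (d M k : nat) : (d <= 1)%nat -> Nat.Even (M + d + k) -> cot_coef d M k = 0.
Proof.
  intros Hd. revert k.
  assert (H : forall k, (Nat.Even (M + d + k) -> cot_coef d M k = 0) /\
             (Nat.Even (M + 1 + d + k) -> cot_coef d (M + 1) k = 0)).
  2:{ intros k. apply H. }
  induction M as [|M IH]; intros k.
  - split; intros [j Hj].
    + destruct d as [|d]; simpl; destruct (Nat.eqb_spec k 0); trivial; lia.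
    + simpl. destruct (Nat.eqb_spec k d); trivial; lia.
  - split; intros [j Hj].
    + rewrite <- Nat.add_1_r in *. apply IH. now exists j.
    + apply Rmult_eq_reg_l with (INR (S M + d)); [|apply not_0_INR; lia].
      rewrite cot_coef_rec by lia. replace (S M - 1)%nat with M by lia.
      rewrite (proj1 (IH k)) by (exists (j - 1)%nat; lia).
      destruct k as [|k]; [simpl; ring|].
      rewrite <- (Nat.add_1_r M) at 1.
      rewrite (proj2 (IH (S k - 1)%nat)) by (exists (j - 1)%nat; lia). ring.
Qed.

Lemma is_RInt_pos_tanh_sech_div_pow (d M N h K : nat) :
  (d <= 1)%nat -> (2 <= N + d)%nat -> (0 < N)%nat -> (N <= M)%nat ->
  (M + N = 2 * h)%nat -> (M + d <= K)%nat ->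
  is_RInt_pos (fun x => tanh_sech d M x * / x ^ N)
    (- PI * (-1) ^ d * (-1) ^ h * moment_sum (pole_zeta (pole_sign d) 0) d M N K).
Proof.
  intros Hd HNd HN HM Hh HK.
  set (yn := fun n => / INR (S (S n))).
  assert (Hyn : forall n, 0 < yn n < 1).
  { intros n. unfold yn. split. apply Rinv_0_lt_compat, lt_0_INR; lia.
    rewrite <- Rinv_1. apply Rinv_lt_contravar. rewrite Rmult_1_l. apply lt_0_INR; lia. apply (lt_INR 1). lia. }
  assert (Hy0 : is_lim_seq yn 0).
  { unfold yn. apply (is_lim_seq_incr_1 (fun n => / INR (S n))). apply (is_lim_seq_incr_1 (fun n => / INR n)).
    replace (Finite 0) with (Rbar_inv p_infty) by reflexivity.
    apply is_lim_seq_inv. apply is_lim_seq_INR. discriminate. }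
  assert (Hsq : is_lim_seq (fun n => 4 * INR N * sqrt (yn n)) 0).
  { replace (Finite 0) with (Rbar_mult (4 * INR N) 0) by (simpl; f_equal; ring).
    apply is_lim_seq_scal_l. rewrite <- sqrt_0.
    apply is_lim_seq_continuous; trivial. apply continuity_pt_sqrt. lra. }
  assert (Hq : Rabs (pole_sign d) <= 1).
  { unfold pole_sign. destruct (Nat.eqb d 0); [rewrite Rabs_R1 | rewrite Rabs_left]; lra. }
  assert (HL : is_lim_seq (fun n => - PI * (-1) ^ d * (-1) ^ h * moment_sum (pole_zeta (pole_sign d) (yn n)) d M N K)
     (- PI * (-1) ^ d * (-1) ^ h * moment_sum (pole_zeta (pole_sign d) 0) d M N K)).
  { apply (is_lim_seq_scal_l _ _ (moment_sum (pole_zeta (pole_sign d) 0) d M N K)).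
    apply (moment_sum_lim (fun n => pole_zeta (pole_sign d) (yn n))).
    intros k Hk. apply pole_zeta_lim; trivial.
    destruct (Nat.le_gt_cases 2 (N + k)) as [H|H]; trivial.
    elim Hk. apply cot_coef_parity; trivial. exists h. lia. }
  (* The weight is the product of [2 / (1 + x)] and [2 * INR N * sqrt (y / x)] without its factor
     [4 * INR N * sqrt y], which tends to 0 by [Hsq]. *)
  apply (is_RInt_pos_approx _ (fun x => / (sqrt x * (1 + x))) (fun x => 2 * atan (sqrt x)) PI).
  - intros x Hx. apply (continuous_mult (tanh_sech d M) (fun x => / x ^ N)). apply tanh_sech_continuous.
    apply (ex_derive_continuous (fun x => / x ^ N)). auto_derive. apply pow_nonzero. lra.
  - intros x Hx. generalize (sqrt_lt_R0 x Hx) (sqrt_sqrt x ltac:(lra)); intros H1 H2.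
    auto_derive; trivial. replace (sqrt x * (sqrt x * 1)) with x by (rewrite Rmult_1_r; auto).
    field. repeat split; lra.
  - intros x Hx. generalize (sqrt_lt_R0 x Hx); intros H1.
    apply (ex_derive_continuous (fun x => / (sqrt x * (1 + x)))). auto_derive.
    repeat split; trivial. apply Rgt_not_eq, Rmult_lt_0_compat; lra.
  - intros x Hx. generalize (atan_bound (sqrt x)); intros H. apply Rabs_le; lra.
  - intros eps He.
    apply is_lim_seq_spec in HL. apply is_lim_seq_spec in Hsq.
    destruct (HL (mkposreal eps He)) as [n1 Hn1]. destruct (Hsq (mkposreal eps He)) as [n2 Hn2].
    simpl in Hn1, Hn2. set (n := max n1 n2).
    specialize (Hn1 n ltac:(lia)). specialize (Hn2 n ltac:(lia)).
    destruct (Hyn n) as [Hyp Hyp1]. set (y := yn n) in *.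
    exists (fun x => tanh_sech d M x * ire y N x).
    eexists. split; [|split].
    + now apply is_RInt_pos_tanh_sech_ire with (h := h) (K := K).
    + lra.
    + intros x Hx. rewrite <- Rmult_minus_distr_l, Rabs_mult.
      generalize (inv_pow_sub_ire_le x y N Hx Hyp HN) (tanh_sech_div_pow_le d M N x Hx HN HM)
        (Rabs_pos (tanh_sech d M x)). intros H1 H2 H3.
      rewrite sqrt_div in H1 by lra.
      generalize (sqrt_lt_R0 x Hx) (sqrt_pos y) (lt_0_INR N HN). intros Hsx Hsy HN'.
      set (A := 2 * INR N * (sqrt y / sqrt x)) in *.
      assert (HA : 0 <= A).
      { unfold A, Rdiv. apply Rmult_le_pos. lra. apply Rmult_le_pos; trivial. now apply Rlt_le, Rinv_0_lt_compat. }
      apply Rle_trans with (Rabs (tanh_sech d M x) * (/ x ^ N * A)). { now apply Rmult_le_compat_l. }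
      rewrite <- Rmult_assoc.
      apply Rle_trans with (2 / (1 + x) * A). { now apply Rmult_le_compat_r. }
      replace (2 / (1 + x) * A) with (4 * INR N * sqrt y * / (sqrt x * (1 + x))) by (unfold A; field; lra).
      apply Rmult_le_compat_r.
      * apply Rlt_le, Rinv_0_lt_compat, Rmult_lt_0_compat; lra.
      * rewrite Rminus_0_r in Hn2. apply Rabs_def2 in Hn2. lra.
Qed.

(** * Power series expansions at 0 *)

Lemma locally_0_of_Rabs (P : R -> Prop) (e : R) : 0 < e ->
  (forall u, Rabs u < e -> P u) -> locally 0 P.
Proof.
  intros He H. exists (mkposreal e He). intros u Hu. apply H.
  unfold ball in Hu; simpl in Hu; unfold AbsRing_ball, abs, minus, plus, opp in Hu; simpl in Hu.
  now rewrite Ropp_0, Rplus_0_r in Hu.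
Qed.

Lemma CV_radius_gt_0 (a : nat -> R) (c : R) : 0 < c ->
  (forall n, Rabs (a n) <= c ^ n) -> Rbar_lt 0 (CV_radius a).
Proof.
  intros Hc H. apply Rbar_lt_le_trans with (/ c). { simpl. now apply Rinv_0_lt_compat. }
  apply (proj1 (CV_radius_bounded a)). exists 1. intros n.
  rewrite Rabs_mult, pow_inv, (Rabs_right (/ _)).
  - assert (Hp : 0 < c ^ n) by now apply pow_lt.
    rewrite <- (Rinv_r (c ^ n)) by lra.
    apply Rmult_le_compat_r; trivial. now apply Rlt_le, Rinv_0_lt_compat.
  - apply Rle_ge, Rlt_le, Rinv_0_lt_compat. now apply pow_lt.
Qed.

Lemma locally_CV_radius (a : nat -> R) : Rbar_lt 0 (CV_radius a) ->
  locally 0 (fun u => Rbar_lt (Rabs u) (CV_radius a)).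
Proof.
  intros H. destruct (CV_radius a) as [r| |]; simpl in H.
  - apply locally_0_of_Rabs with (1 := H). trivial.
  - apply locally_0_of_Rabs with 1; simpl; trivial; lra.
  - easy.
Qed.

(** Outside the disk of convergence the terms do not tend to 0, which convergence at the positive
    point [e / 2] excludes. *)
Lemma expansion_radius (F : R -> R) (a : nat -> R) :
  is_expansion F a -> Rbar_lt 0 (CV_radius a).
Proof.
  intros [e He]. set (x := e / 2).
  assert (Hx : 0 < x) by (unfold x; generalize (cond_pos e); lra).
  apply Rbar_lt_le_trans with (Rabs x). { simpl. rewrite Rabs_right; lra. }
  apply Rbar_not_lt_le. intros Hlt. apply (CV_disk_outside a x Hlt).
  apply ex_series_lim_0. exists (F x). apply (proj1 (is_pseries_R a x (F x))). apply He.
  unfold ball; simpl; unfold AbsRing_ball, abs, minus, plus, opp; simpl.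
  rewrite Ropp_0, Rplus_0_r, Rabs_right by lra. unfold x. generalize (cond_pos e); lra.
Qed.

Lemma expansion_unique (F : R -> R) (a b : nat -> R) (n : nat) :
  is_expansion F a -> is_expansion F b -> a n = b n.
Proof.
  intros Ha Hb. apply PSeries_ext_recip; [eapply expansion_radius; eassumption.. |].
  generalize (filter_and _ _ Ha Hb). apply filter_imp. intros u [H1 H2].
  now rewrite (is_pseries_unique _ _ _ H1), (is_pseries_unique _ _ _ H2).
Qed.

Lemma coef_expansion (F : R -> R) (a : nat -> R) (r : nat) :
  is_expansion F a -> coef r F = a r.
Proof.
  intros H. unfold coef. apply (iota_unique (V := R_CompleteNormedModule)).
  - intros y [b [Hb <-]]. now apply (expansion_unique F).
  - now exists a.
Qed.

Lemma expansion_ext (F G : R -> R) (a : nat -> R) :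
  locally 0 (fun u => F u = G u) -> is_expansion F a -> is_expansion G a.
Proof.
  unfold is_expansion. intros HFG Ha. generalize (filter_and _ _ HFG Ha). apply filter_imp. now intros u [<- H].
Qed.

Lemma expansion_mult (F G : R -> R) (a b : nat -> R) :
  is_expansion F a -> is_expansion G b -> is_expansion (fun u => F u * G u) (PS_mult a b).
Proof.
  unfold is_expansion. intros Ha Hb.
  generalize (filter_and _ _ (filter_and _ _ Ha Hb)
    (filter_and _ _ (locally_CV_radius a (expansion_radius _ _ Ha)) (locally_CV_radius b (expansion_radius _ _ Hb)))).
  apply filter_imp. intros u [[H1 H2] [H3 H4]]. now apply is_pseries_mult.
Qed.

Lemma expansion_const (c : R) : is_expansion (fun _ => c) (fun n => if Nat.eqb n 0 then c else 0).
Proof.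
  unfold is_expansion. apply filter_forall. intros u. apply is_pseries_R.
  change (is_lim_seq (sum_n (fun n => (if Nat.eqb n 0 then c else 0) * u ^ n)) c).
  apply is_lim_seq_ext with (fun _ => c).
  - intros n. induction n as [|n IH]. rewrite sum_O. simpl. eq_over_R. ring.
    rewrite sum_n_SR, <- IH. simpl. eq_over_R. ring.
  - apply is_lim_seq_const.
Qed.

Lemma expansion_pow (F : R -> R) (a : nat -> R) (n : nat) :
  is_expansion F a -> exists b, is_expansion (fun u => F u ^ n) b.
Proof.
  intros Ha. induction n as [|n [b Hb]].
  - eexists. apply (expansion_const 1).
  - exists (PS_mult a b). now apply expansion_mult.
Qed.

Lemma expansion_incr (F : R -> R) (a : nat -> R) :
  is_expansion F a -> is_expansion (fun u => u * F u) (PS_incr_1 a).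
Proof.
  unfold is_expansion. apply filter_imp. intros u. apply (is_pseries_incr_1 a u (F u)).
Qed.

Lemma expansion_scal (F : R -> R) (a : nat -> R) (c : R) :
  is_expansion F a -> is_expansion (fun u => c * F u) (fun n => c * a n).
Proof.
  unfold is_expansion. apply filter_imp. intros u. apply (is_pseries_scal c a u (F u)). apply Rmult_comm.
Qed.

Lemma expansion_minus (F G : R -> R) (a b : nat -> R) :
  is_expansion F a -> is_expansion G b -> is_expansion (fun u => F u - G u) (fun n => a n - b n).
Proof.
  unfold is_expansion. intros Ha Hb. generalize (filter_and _ _ Ha Hb). apply filter_imp. intros u [H1 H2].
  apply (is_pseries_minus a b u (F u) (G u) H1 H2).
Qed.

Lemma expansion_derive (F : R -> R) (a : nat -> R) :
  is_expansion F a ->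
  locally 0 (fun u => is_derive F u (PSeries (PS_derive a) u)) /\
  is_expansion (PSeries (PS_derive a)) (PS_derive a).
Proof.
  unfold is_expansion. intros Ha. generalize (locally_CV_radius a (expansion_radius _ _ Ha)). intros Hr. split.
  - generalize (filter_and _ _ (locally_locally _ _ Ha) Hr). apply filter_imp. intros u [H1 H2].
    apply (is_derive_ext_loc (PSeries a)).
    + revert H1. apply filter_imp. intros t Ht. now apply is_pseries_unique.
    + now apply is_derive_PSeries.
  - revert Hr. apply filter_imp. intros u H. apply PSeries_correct. now apply ex_pseries_derive.
Qed.

(** A coefficient of the reciprocal depends on all earlier ones, so the recursion carries a table,
    correct at indices up to [n]; the values beyond are placeholders. *)
Fixpoint reciprocal_table (a : nat -> R) (n : nat) : nat -> R :=
  match n with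
  | O => fun _ => 1
  | S n1 => fun k =>
      if Nat.leb k n1 then reciprocal_table a n1 k
      else - sum_f_R0 (fun j => a (S j) * reciprocal_table a n1 (n1 - j)) n1
  end.

Definition PS_reciprocal (a : nat -> R) (n : nat) : R := reciprocal_table a n n.

Lemma reciprocal_table_stable (a : nat -> R) (n k : nat) : (k <= n)%nat ->
  reciprocal_table a n k = PS_reciprocal a k.
Proof.
  intros Hk. induction n as [|n IH].
  - now replace k with 0%nat by lia.
  - destruct (Nat.eq_dec k (S n)) as [->|Hne]; trivial.
    simpl. rewrite (proj2 (Nat.leb_le k n)) by lia. apply IH. lia.
Qed.

Lemma PS_reciprocal_S (a : nat -> R) (n : nat) :
  PS_reciprocal a (S n) = - sum_f_R0 (fun j => a (S j) * PS_reciprocal a (n - j)) n.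
Proof.
  unfold PS_reciprocal at 1. cbn [reciprocal_table].
  rewrite (proj2 (Nat.leb_gt (S n) n)) by lia. f_equal.
  apply sum_eq. intros j Hj. now rewrite reciprocal_table_stable by lia.
Qed.

Lemma PS_mult_reciprocal (a : nat -> R) (n : nat) : a 0%nat = 1 ->
  PS_mult a (PS_reciprocal a) n = if Nat.eqb n 0 then 1 else 0.
Proof.
  intros Ha. destruct n as [|n]; unfold PS_mult.
  - simpl. rewrite Ha. unfold PS_reciprocal. simpl. ring.
  - rewrite decomp_sum by lia. rewrite Nat.sub_0_r, PS_reciprocal_S, Ha. simpl. ring.
Qed.

(** Strong induction: the sum of [2 ^ (n - j)] over [j <= n] is [2 ^ S n - 1]. *)
Lemma PS_reciprocal_bound (a : nat -> R) (n : nat) : (forall k, Rabs (a k) <= 1) ->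
  Rabs (PS_reciprocal a n) <= 2 ^ n.
Proof.
  intros Ha. induction n as [n IH] using (well_founded_induction Nat.lt_wf_0).
  destruct n as [|n].
  - unfold PS_reciprocal. simpl. rewrite Rabs_R1. lra.
  - rewrite PS_reciprocal_S, Rabs_Ropp.
    apply Rle_trans with (1 := Rsum_abs _ _).
    apply Rle_trans with (sum_f_R0 (fun j => 2 ^ (n - j)) n).
    + apply sum_Rle. intros j Hj. rewrite Rabs_mult.
      generalize (Ha (S j)) (IH (n - j)%nat ltac:(lia)) (Rabs_pos (a (S j))) (Rabs_pos (PS_reciprocal a (n - j))).
      nra.
    + clear. assert (H : sum_f_R0 (fun j => 2 ^ (n - j)) n = 2 ^ S n - 1).
      { induction n as [|n IH].
        - simpl. ring.
        - rewrite decomp_sum by lia. simpl pred. rewrite Nat.sub_0_r.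
          rewrite (sum_eq (fun i => 2 ^ (S n - S i)) (fun j => 2 ^ (n - j))) by (intros; reflexivity).
          rewrite IH. simpl. ring. }
      rewrite H. lra.
Qed.

(** The geometric bound gives the formal inverse a positive radius. Near 0 its sum times [F] is then
    1, which also shows [F u <> 0]. *)
Lemma expansion_reciprocal (F : R -> R) (a : nat -> R) :
  is_expansion F a -> a 0%nat = 1 -> (forall n, Rabs (a n) <= 1) ->
  is_expansion (fun u => / F u) (PS_reciprocal a).
Proof.
  intros Ha H0 H1.
  assert (Hr : Rbar_lt 0 (CV_radius (PS_reciprocal a))).
  { apply CV_radius_gt_0 with 2. lra. intros n. now apply PS_reciprocal_bound. }
  generalize (locally_CV_radius _ Hr). intros Hl.
  assert (Hb : is_expansion (PSeries (PS_reciprocal a)) (PS_reciprocal a)).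
  { unfold is_expansion. revert Hl. apply filter_imp. intros u Hu.
    apply PSeries_correct. now apply CV_radius_inside. }
  apply (expansion_ext (PSeries (PS_reciprocal a))); trivial.
  generalize (filter_and _ _ (expansion_mult _ _ _ _ Ha Hb) (expansion_const 1)).
  apply filter_imp. intros u [Hm Hc].
  apply is_pseries_unique in Hm. apply is_pseries_unique in Hc.
  rewrite (PSeries_ext _ _ u (fun n => PS_mult_reciprocal a n H0)), Hc in Hm.
  assert (F u <> 0) by (intros E; rewrite E, Rmult_0_l in Hm; lra).
  apply Rmult_eq_reg_l with (F u); trivial. rewrite Rinv_r by trivial. now symmetry.
Qed.

Definition PS_even (a : nat -> R) (n : nat) : R :=
  if Nat.even n then a (Nat.div2 n) else 0.

Lemma is_pseries_even (a : nat -> R) (u l : R) :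
  infinite_sum (fun i => a i * (Rsqr u) ^ i) l -> is_pseries (PS_even a) u l.
Proof.
  intros H. rewrite <- (Rplus_0_r l). rewrite <- (Rmult_0_r u).
  apply is_pseries_odd_even.
  - apply is_pseries_R, is_series_Reals. revert H.
    rewrite Rsqr_pow2. intros H.
    apply (is_series_Reals (fun n => PS_even a (2 * n) * (u ^ 2) ^ n)).
    apply is_series_Reals in H. revert H. apply is_series_ext. intros n.
    unfold PS_even. rewrite Nat.even_mul, Nat.div2_double. reflexivity.
  - apply is_pseries_R. apply (is_series_ext (fun _ => 0)).
    + intros n. unfold PS_even. rewrite Nat.even_add, Nat.even_mul. simpl. eq_over_R. ring.
    + change (is_lim_seq (sum_n (fun _ : nat => 0)) 0). apply is_lim_seq_ext with (fun _ => 0).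
      * intros n. rewrite sum_n_const. eq_over_R. ring.
      * apply is_lim_seq_const.
Qed.

Lemma expansion_cos : is_expansion cos (PS_even cos_n).
Proof.
  unfold is_expansion. apply filter_forall. intros u. apply is_pseries_even.
  unfold cos. destruct (exist_cos (Rsqr u)) as [l Hl]. exact Hl.
Qed.

(** Taking the limit from which [sin] itself is defined makes [sin u = u * sinc u] hold by
    unfolding, also at 0, with no division. *)
Definition sinc (u : R) : R := let (l, _) := exist_sin (Rsqr u) in l.

Lemma expansion_sinc : is_expansion sinc (PS_even sin_n).
Proof.
  unfold is_expansion. apply filter_forall. intros u. apply is_pseries_even.
  unfold sinc. destruct (exist_sin (Rsqr u)) as [l Hl]. exact Hl.
Qed.

Lemma sin_sinc (u : R) : sin u = u * sinc u.
Proof. unfold sin, sinc. now destruct (exist_sin (Rsqr u)). Qed.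

Lemma sinc_0 : sinc 0 = 1.
Proof.
  assert (H : is_pseries (PS_even sin_n) 0 (sinc 0)).
  { apply is_pseries_even. unfold sinc. destruct (exist_sin (Rsqr 0)) as [l Hl]. exact Hl. }
  apply is_pseries_unique in H. rewrite <- H, PSeries_0.
  unfold PS_even, sin_n. simpl. field.
Qed.

Lemma u_over_sin_sinc (u : R) : u_over_sin u = / sinc u.
Proof.
  unfold u_over_sin. destruct (Req_EM_T u 0) as [->|Hu].
  - rewrite sinc_0. field.
  - rewrite sin_sinc. unfold Rdiv. rewrite Rinv_mult, <- Rmult_assoc, Rinv_r by trivial. ring.
Qed.

Lemma u_cot_cos (u : R) : u_cot u = cos u * u_over_sin u.
Proof.
  unfold u_cot, u_over_sin. destruct (Req_EM_T u 0) as [->|Hu].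
  - rewrite cos_0. ring.
  - unfold Rdiv. ring.
Qed.

Lemma PS_even_sin_n_bound (n : nat) : Rabs (PS_even sin_n n) <= 1.
Proof.
  unfold PS_even. destruct (Nat.even n); [|rewrite Rabs_R0; lra].
  unfold sin_n, Rdiv. rewrite Rabs_mult, pow_1_abs, Rmult_1_l.
  assert (H : 1 <= INR (Factorial.fact (2 * Nat.div2 n + 1))).
  { apply (le_INR 1). generalize (Factorial.lt_O_fact (2 * Nat.div2 n + 1)). lia. }
  rewrite Rabs_right. rewrite <- Rinv_1. apply Rinv_le_contravar; lra.
  apply Rle_ge, Rlt_le, Rinv_0_lt_compat. lra.
Qed.

Lemma expansion_u_over_sin : is_expansion u_over_sin (PS_reciprocal (PS_even sin_n)).
Proof.
  apply (expansion_ext (fun u => / sinc u)).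
  - apply filter_forall. intros u. now rewrite u_over_sin_sinc.
  - apply expansion_reciprocal.
    + apply expansion_sinc.
    + unfold PS_even, sin_n. simpl. field.
    + apply PS_even_sin_n_bound.
Qed.

(** * Coefficients of [(u / sin u)^d (u cot u)^M] *)

Definition csc_cot (d M : nat) (u : R) : R := u_over_sin u ^ d * u_cot u ^ M.

Lemma csc_cot_0 (d M : nat) : csc_cot d M 0 = 1.
Proof.
  unfold csc_cot, u_over_sin, u_cot. destruct (Req_EM_T 0 0); [|easy]. rewrite !pow1. ring.
Qed.

Lemma expansion_csc_cot (d M : nat) : exists a, is_expansion (csc_cot d M) a.
Proof.
  assert (Hc : is_expansion u_cot (PS_mult (PS_even cos_n) (PS_reciprocal (PS_even sin_n)))).
  { apply (expansion_ext (fun u => cos u * u_over_sin u)).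
    - apply filter_forall. intros u. now rewrite u_cot_cos.
    - apply expansion_mult. apply expansion_cos. apply expansion_u_over_sin. }
  destruct (expansion_pow _ _ d expansion_u_over_sin) as [a Ha].
  destruct (expansion_pow _ _ M Hc) as [b Hb].
  exists (PS_mult a b). now apply (expansion_mult (fun u => u_over_sin u ^ d) (fun u => u_cot u ^ M)).
Qed.

Lemma sin_neq_0 (u : R) : u <> 0 -> Rabs u < 1 -> sin u <> 0.
Proof.
  intros Hu H. apply Rabs_def2 in H. generalize PI2_1. intros HP.
  destruct (Rlt_le_dec 0 u).
  - apply Rgt_not_eq, sin_gt_0; lra.
  - apply Rlt_not_eq, sin_lt_0_var; lra.
Qed.

Lemma is_derive_u_over_sin (u : R) : u <> 0 -> Rabs u < 1 ->
  is_derive u_over_sin u (u_over_sin u * (1 - u_cot u) / u).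
Proof.
  intros Hu H1. generalize (sin_neq_0 u Hu H1). intros Hs.
  apply (is_derive_ext_loc (fun t => t / sin t)).
  - apply (locally_open (fun t => t <> 0)); [apply open_neq | | trivial].
    intros t Ht. unfold u_over_sin. now destruct (Req_EM_T t 0).
  - unfold u_over_sin, u_cot. destruct (Req_EM_T u 0); [easy|].
    auto_derive; trivial. field. now split.
Qed.

Lemma is_derive_u_cot (u : R) : u <> 0 -> Rabs u < 1 ->
  is_derive u_cot u ((u_cot u - u ^ 2 - u_cot u ^ 2) / u).
Proof.
  intros Hu H1. generalize (sin_neq_0 u Hu H1). intros Hs.
  apply (is_derive_ext_loc (fun t => t * (cos t / sin t))).
  - apply (locally_open (fun t => t <> 0)); [apply open_neq | | trivial].
    intros t Ht. unfold u_cot. now destruct (Req_EM_T t 0).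
  - unfold u_cot. destruct (Req_EM_T u 0); [easy|].
    auto_derive; trivial. field. now split.
Qed.

(** Coefficients of the differential equation are compared: [u W'] multiplies the r-th one by [r],
    and [u^2] shifts by two, which explains the case [r < 2]. *)
Lemma coef_csc_cot_rec (d M r : nat) :
  INR (M + d) * coef r (csc_cot d (M + 1)) =
  (INR (M + d) - INR r) * coef r (csc_cot d M)
  - INR M * (if Nat.leb 2 r then coef (r - 2) (csc_cot d (M - 1)) else 0).
Proof.
  destruct (expansion_csc_cot d M) as [a Ha].
  destruct (expansion_csc_cot d (M + 1)) as [b Hb].
  destruct (expansion_csc_cot d (M - 1)) as [c Hc].
  destruct (expansion_derive _ _ Ha) as [HD HDa].
  assert (HL := expansion_incr _ _ HDa).
  assert (HR := expansion_minus _ _ _ _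
     (expansion_minus _ _ _ _ (expansion_scal _ _ (INR (M + d)) Ha) (expansion_scal _ _ (INR (M + d)) Hb))
     (expansion_scal _ _ (INR M) (expansion_incr _ _ (expansion_incr _ _ Hc)))).
  assert (HE : is_expansion (fun u => u * PSeries (PS_derive a) u)
    (fun n => INR (M + d) * a n - INR (M + d) * b n - INR M * PS_incr_1 (PS_incr_1 c) n)).
  { revert HR. apply expansion_ext.
    assert (H1 : locally 0 (fun u => Rabs u < 1)) by (apply locally_0_of_Rabs with 1; trivial; lra).
    generalize (filter_and _ _ HD H1). apply filter_imp. intros u [Hd Hu].
    (* The derivative formulas divide by [u], so the origin is checked apart; both sides are 0
       there. *)
    destruct (Req_dec u 0) as [->|Hu0].
    - rewrite !csc_cot_0. ring.
    - generalize (is_derive_pow _ d _ _ (is_derive_u_over_sin u Hu0 Hu))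
        (is_derive_pow _ M _ _ (is_derive_u_cot u Hu0 Hu)). intros D1 D2.
      generalize (is_derive_mult (fun t => u_over_sin t ^ d) (fun t => u_cot t ^ M) u _ _ D1 D2 Rmult_comm).
      intros D3. apply is_derive_unique in D3. apply is_derive_unique in Hd.
      generalize (eq_trans (eq_sym Hd) D3). intros ->. unfold csc_cot.
      change (plus ?p ?q) with (p + q).
      change (mult (INR d * (u_over_sin u * (1 - u_cot u) / u) * u_over_sin u ^ pred d) (u_cot u ^ M))
        with (INR d * (u_over_sin u * (1 - u_cot u) / u) * u_over_sin u ^ pred d * u_cot u ^ M).
      change (mult (u_over_sin u ^ d) (INR M * ((u_cot u - u ^ 2 - u_cot u ^ 2) / u) * u_cot u ^ pred M))
        with (u_over_sin u ^ d * (INR M * ((u_cot u - u ^ 2 - u_cot u ^ 2) / u) * u_cot u ^ pred M)).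
      set (s := u_over_sin u). set (t := u_cot u).
      assert (E1 : INR d * (s * (1 - t) / u) * s ^ pred d = INR d * s ^ d * (1 - t) / u).
      { destruct d as [|d']; simpl; field; trivial. }
      assert (E2 : INR M * ((t - u ^ 2 - t ^ 2) / u) * t ^ pred M = INR M * (t ^ M - u ^ 2 * t ^ (M - 1) - t ^ M * t) / u).
      { destruct M as [|M']. simpl; field; trivial. replace (S M' - 1)%nat with M' by lia. simpl; field; trivial. }
      rewrite E1, E2, plus_INR, pow_add, pow_1. field. trivial. }
  assert (H := expansion_unique _ _ _ r HL HE).
  rewrite (coef_expansion _ _ _ Ha), (coef_expansion _ _ _ Hb), (coef_expansion _ _ _ Hc).
  assert (Hl : @eq R (PS_incr_1 (PS_derive a) r) (INR r * a r)).
  { destruct r as [|r]; simpl PS_incr_1. change (0 = 0 * a 0%nat). ring. reflexivity. }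
  assert (Hr : @eq R (PS_incr_1 (PS_incr_1 c) r) (if Nat.leb 2 r then c (r - 2)%nat else 0)).
  { destruct r as [|[|r]]; try reflexivity. simpl. now rewrite Nat.sub_0_r. }
  rewrite Hl, Hr in H. lra.
Qed.

Lemma coef_0_csc_cot (d M : nat) : coef 0 (csc_cot d M) = 1.
Proof.
  destruct (expansion_csc_cot d M) as [a Ha]. rewrite (coef_expansion _ _ _ Ha).
  apply locally_singleton in Ha. apply is_pseries_unique in Ha. rewrite PSeries_0, csc_cot_0 in Ha. exact Ha.
Qed.

(** Under [r = M + d - 1 - k] the two recursions coincide; stepping from [m] to [m + 1], the factor
    [INR (m + d) - INR r] becomes [INR k]. *)
Lemma coef_csc_cot (d M r : nat) : (d <= 1)%nat -> (r < M + d)%nat ->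
  coef r (csc_cot d M) = cot_coef d M (M + d - 1 - r).
Proof.
  intros Hd. revert r.
  set (P := fun M => forall r, (r < M + d)%nat -> coef r (csc_cot d M) = cot_coef d M (M + d - 1 - r)).
  assert (Hstep : forall M, (0 < M + d)%nat -> (M = 0%nat \/ P (M - 1)%nat) -> P M -> P (M + 1)%nat).
  { intros m Hm H1 H2 r Hr.
    apply Rmult_eq_reg_l with (INR (m + d)); [|apply not_0_INR; lia].
    rewrite coef_csc_cot_rec, cot_coef_rec by lia.
    replace (m + 1 + d - 1 - r)%nat with (m + d - r)%nat by lia. f_equal.
    (* At [r = m + d] the induction hypothesis does not apply, but the factor in front is 0. *)
    - rewrite <- minus_INR by lia. destruct (Nat.eq_dec r (m + d)) as [->|Hne].
      + rewrite Nat.sub_diag. change (INR 0) with 0. now rewrite !Rmult_0_l.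
      + rewrite H2 by lia. do 2 f_equal. lia.
    - destruct m as [|m]; [change (INR 0) with 0; now rewrite !Rmult_0_l|]. f_equal.
      replace (S m - 1)%nat with m in * by lia.
      destruct (Nat.leb_spec 2 r) as [Hr2|Hr2].
      + destruct H1 as [H1|H1]; [lia|]. rewrite H1 by lia. f_equal. lia.
      (* For [r < 2] the index on the other side is at least [m + d], beyond the last nonzero
         coefficient. *)
      + symmetry. apply cot_coef_eq_0; lia. }
  assert (H01 : P 0%nat /\ P 1%nat).
  { destruct d as [|d].
    - split; intros r Hr; [lia|]. replace r with 0%nat by lia. now rewrite coef_0_csc_cot.
    - assert (d = 0%nat) as -> by lia.
      assert (H0 : P 0%nat). { intros r Hr. replace r with 0%nat by lia. now rewrite coef_0_csc_cot. }
      split; trivial. apply (Hstep 0%nat); auto. }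
  change (P M).
  assert (HP : P M /\ P (S M)).
  { induction M as [|m [IH1 IH2]]; trivial. split; trivial.
    rewrite <- (Nat.add_1_r (S m)). apply Hstep; trivial. lia.
    right. now replace (S m - 1)%nat with m by lia. }
  apply HP.
Qed.

(** * Translation into the Lerch transcendent and reindexing *)

Lemma pole_zeta_Lerch (q : R) (s : nat) :
  pole_zeta q 0 s = / PI ^ s * Lerch q (INR s) (1 / 2).
Proof.
  unfold pole_zeta, Lerch. rewrite <- Series_scal_l. apply Series_ext. intros j.
  generalize (pos_INR j) PI_RGT_0. intros Hj HP.
  rewrite Rpower_pow by lra. unfold pole. rewrite Rplus_0_r, Rpow_mult_distr.
  field. split; apply pow_nonzero; lra.
Qed.

Lemma sum_n_m_shift (g : nat -> R) (a K : nat) :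
  sum_n_m g a (a + K) = sum_n (fun i => g (a + i)%nat) K.
Proof.
  induction K as [|K IH].
  - rewrite sum_O, Nat.add_0_r. apply sum_n_n.
  - rewrite sum_n_SR, <- IH, Nat.add_succ_r, sum_n_Sm by lia. reflexivity.
Qed.

Lemma sum_n_parity (f : nat -> R) (b K : nat) :
  (b <= 1)%nat -> (b = 1%nat -> f 0%nat = 0) -> (forall i, f (2 * i + b + 1)%nat = 0) ->
  sum_n f (2 * K + b + 1) = sum_n (fun i => f (2 * i + b)%nat) K.
Proof.
  intros Hb H0 Hf. induction K as [|K IH].
  - generalize (Hf 0%nat). rewrite sum_O.
    destruct b as [|[|b]]; try lia; simpl; intros E; rewrite !sum_n_SR, sum_O, E; eq_over_R.
    + ring.
    + rewrite H0 by trivial. ring.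
  - replace (2 * S K + b + 1)%nat with (S (S (2 * K + b + 1))) by lia.
    rewrite !sum_n_SR, IH.
    replace (S (S (2 * K + b + 1))) with (2 * S K + b + 1)%nat by lia. rewrite Hf.
    replace (S (2 * K + b + 1)) with (2 * S K + b)%nat by lia. eq_over_R. ring.
Qed.

Theorem proposition3p5 (m n eps : nat)
    (hn : (1 <= n)%nat) (hnm : (n <= m)%nat) (hpar : Nat.Even (m + n))
    (heps : eps = 0%nat \/ eps = 1%nat) :
  is_RInt_gen
    (fun x : R => tanh x ^ (m + eps) / (x ^ (n + eps) * cosh x ^ (1 - eps)))
    (at_right 0) (Rbar_locally p_infty)
    ((-1) ^ Nat.div (m - n) 2 *
     sum_n_m
       (fun p : nat =>
          Binomial.C (2 * p - 1 + eps) (n - 1 + eps) *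
          (Lerch (2 * INR eps - 1) (INR (2 * p + eps)) (1 / 2)
             / PI ^ (2 * p - 1 + eps)) *
          coef (m + n - 2 * p)
            (fun u : R => u_over_sin u ^ (1 - eps) * u_cot u ^ (m + eps)))
       (Nat.div (n + 1) 2) (Nat.div (m + n) 2)).
Proof.
  set (d := (1 - eps)%nat).
  assert (Hde : (d + eps = 1)%nat) by (unfold d; lia).
  (* The common parity [b] of [m] and [n] turns all the integer quotients into exact expressions in
     [a], [b], [c]. *)
  assert (Hab : exists a b c, (b <= 1)%nat /\ n = (2 * a + b)%nat /\ m = (2 * c + b)%nat /\ (a <= c)%nat).
  { destruct hpar as [h Hh]. exists (n / 2)%nat, (n mod 2)%nat, (m / 2)%nat.
    generalize (Nat.div_mod_eq n 2) (Nat.div_mod_eq m 2) (Nat.mod_upper_bound n 2) (Nat.mod_upper_bound m 2).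
    intros. repeat split; lia. }
  destruct Hab as [a [b [c [Hb [Hn [Hm Hac]]]]]].
  assert (E1 : ((m - n) / 2 = c - a)%nat).
  { replace (m - n)%nat with ((c - a) * 2)%nat by lia. now apply Nat.div_mul. }
  assert (E2 : ((m + n) / 2 = a + b + c)%nat).
  { replace (m + n)%nat with ((a + b + c) * 2)%nat by lia. now apply Nat.div_mul. }
  assert (E3 : ((n + 1) / 2 = a + b)%nat).
  { destruct b as [|[|b]]; try lia.
    - replace (n + 1)%nat with (1 + a * 2)%nat by lia. rewrite Nat.div_add by lia. simpl. lia.
    - replace (n + 1)%nat with ((a + 1) * 2)%nat by lia. now apply Nat.div_mul. }
  rewrite E1, E2, E3.
  assert (Hq : pole_sign d = 2 * INR eps - 1).
  { unfold d. destruct heps as [->| ->]; unfold pole_sign; simpl; ring. }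
  (* Half of [(m + eps) + (n + eps)] is [a + b + c + eps], and the bound [2 * c + b + 1] is exactly
     [(m + eps) + d]. *)
  generalize (is_RInt_pos_tanh_sech_div_pow d (m + eps) (n + eps) (a + b + c + eps) (2 * c + b + 1)
    ltac:(lia) ltac:(lia) ltac:(lia) ltac:(lia) ltac:(lia) ltac:(lia)).
  intros H.
  match type of H with is_RInt_pos _ ?u =>
    match goal with |- is_RInt_gen _ _ _ ?v => assert (E : u = v) end end.
  2:{ rewrite <- E. revert H. apply is_RInt_pos_ext. intros x Hx.
      unfold tanh_sech, Rdiv. rewrite Rinv_mult, pow_inv. ring. }
  (* Only the indices [k = 2 * i + b] survive, and they correspond to [p = a + b + i], since then
     [n + eps + k = 2 * p + eps]. *)
  unfold moment_sum. rewrite sum_n_m_shift, sum_n_parity; trivial.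
  - change (fun u : R => u_over_sin u ^ d * u_cot u ^ (m + eps)) with (csc_cot d (m + eps)).
    rewrite <- !(sum_n_mult_l (K := R_Ring)). apply sum_n_ext_loc. intros i Hi.
    change (mult ?u ?v) with (u * v).
    rewrite coef_csc_cot by lia.
    replace (m + eps + d - 1 - (m + n - 2 * (a + b + i)))%nat with (2 * i + b)%nat by lia.
    rewrite pole_zeta_Lerch, Hq.
    replace (n + eps + (2 * i + b))%nat with (2 * (a + b + i) + eps)%nat by lia.
    replace (n + eps - 1)%nat with (n - 1 + eps)%nat by lia.
    replace (2 * (a + b + i) + eps - 1)%nat with (2 * (a + b + i) - 1 + eps)%nat by lia.
    (* The factor [PI] split off here cancels the one in front of [moment_sum]. *)
    replace (PI ^ (2 * (a + b + i) + eps)) with (PI * PI ^ (2 * (a + b + i) - 1 + eps))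
      by (rewrite tech_pow_Rmult; f_equal; lia).
    assert (Hs : - (-1) ^ d * (-1) ^ (a + b + c + eps) * (-1) ^ (2 * i + b) = (-1) ^ (c - a)).
    {
      transitivity (- ((-1) ^ (d + eps)) * (-1) ^ (2 * (a + b + i)) * (-1) ^ (c - a)).
      - replace (a + b + c + eps)%nat with (2 * a + b + (c - a) + eps)%nat by lia.
        replace (2 * (a + b + i))%nat with (2 * a + b + (2 * i + b))%nat by lia.
        rewrite !pow_add. ring.
      - rewrite Hde, pow_1_even. ring. }
    rewrite <- Hs. generalize PI_RGT_0. intros HP.
    eq_over_R. field. split; [apply pow_nonzero|]; lra.
  (* For odd [m] the index 0 has the wrong parity and must be discarded separately, as the surviving
     indices start at 1. *)
  - intros ->. rewrite cot_coef_parity; [ring | lia | exists (c + 1)%nat; lia].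
  - intros i. rewrite (cot_coef_parity d (m + eps)); [ring | lia | exists (c + i + b + 1)%nat; lia].
Qed.
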